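(* Weighted coloured token swapping on a star is solved optimally by the following algorithm: construct the token-vertex assignment $T_A$ (assign each leaf loop's token to its own vertex; for each connected component of $G'$ choose an Eulerian circuit, and if its edges in circuit order are labelled by star vertices $v_1,\dots,v_b$, with $t_i$ the initial token of $v_i$, assign $t_i$ to $v_{i+1}$, indices modulo $b$), and then compute a minimum-cost swap sequence for the weighted uncoloured instance defined by $T_A$. That is, $F(T_A)=\min_T F(T)$ over all token-vertex assignments $T$, and this minimum is the minimum cost of the weighted coloured instance; in particular the problem is solvable in polynomial time.
   Context: Weighted coloured token swapping on a star: a star (tree with one non-leaf vertex $u$, the center); each vertex has a colour and carries one coloured token initially, with equally many tokens and vertices of each colour; each colour $c$ has a positive weight $w(c)$, and swapping tokens of colours $c,c'$ costs $w(c)+w(c')$; the goal is a minimum-cost swap sequence after which each token is on a vertex of its own colour. A token-vertex assignment $T$ is a colour-preserving bijection from tokens to vertices, defining an uncoloured weighted instance where each token must reach its assigned vertex; $F(T)$ is the minimum cost of a swap sequence solving that instance. The directed multigraph $G$ has the colours as vertices and, for each star vertex $v$ of colour $c$ whose initial token has colour $d$, a directed edge $c\to d$ labelled $v$. A leaf loop is a loop labelled by a leaf. $G'$ is $G$ with all leaf loops removed; every vertex of $G'$ has in-degree equal to out-degree, so each connected component with edges has an Eulerian circuit. An edge labelled $v_i$ goes from the colour of $v_i$ to the colour of its initial token, so consecutive edges in a circuit make $t_i$ and $v_{i+1}$ have the same colour. *)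

(* Defs.v *)
From HB Require Import structures.
From mathcomp Require Import all_boot all_order all_algebra all_fingroup.

Set Implicit Arguments.
Unset Strict Implicit.
Unset Printing Implicit Defensive.

Import Order.TTheory GRing.Theory Num.Theory.
Local Open Scope ring_scope.

(** * Stars *)

Definition leaf (V : finType) (e : rel V) (v : V) : bool :=
  #|[set w | e v w]| == 1%N.

(* A cycle of a simple graph has at least three vertices: [:: x; y] satisfies
   [ucycle e] as soon as x and y are adjacent. *)
Definition is_tree (V : finType) (e : rel V) : Prop :=
  [/\ symmetric e, irreflexive e, (forall x y, connect e x y)
    & forall c : seq V, ucycle e c -> (size c <= 2)%N].

Definition is_star (V : finType) (e : rel V) (u : V) : Prop :=
  is_tree e /\ forall v, ~~ leaf e v = (v == u).

(** * Weighted coloured token swapping *)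

(* V is the set of vertices and C the set of colours.  A token is identified
   with the vertex that carries it initially, so [tcol v] is the colour of the
   initial token of v. *)
Record instance (R : realFieldType) (V C : finType) := Instance {
  adj : rel V;
  centre : V;
  vcol : V -> C;
  tcol : V -> C;
  weight : C -> R
}.

Definition star_instance (R : realFieldType) (V C : finType)
    (I : instance R V C) : Prop :=
  [/\ is_star (adj I) (centre I),
      (forall c, #|[set v | tcol I v == c]| = #|[set v | vcol I v == c]|)
    & forall c, 0 < weight I c].

(* A placement s maps each vertex to the token it currently carries; the
   initial placement is the identity. *)
Definition swap (V : finType) (x y : V) (s : {perm V}) : {perm V} :=
  (tperm x y * s)%g.

Fixpoint run (V : finType) (s : {perm V}) (sigma : seq (V * V)) : {perm V} :=
  if sigma is e :: sigma' then run (swap e.1 e.2 s) sigma' else s.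

Fixpoint cost_from (R : realFieldType) (V C : finType) (I : instance R V C)
    (s : {perm V}) (sigma : seq (V * V)) : R :=
  if sigma is e :: sigma' then
    weight I (tcol I (s e.1)) + weight I (tcol I (s e.2))
      + cost_from I (swap e.1 e.2 s) sigma'
  else 0.

Definition cost (R : realFieldType) (V C : finType) (I : instance R V C)
    (sigma : seq (V * V)) : R := cost_from I 1%g sigma.

Definition swap_sequence (R : realFieldType) (V C : finType)
    (I : instance R V C) (sigma : seq (V * V)) : bool :=
  all (fun e => adj I e.1 e.2) sigma.

Definition solves_coloured (R : realFieldType) (V C : finType)
    (I : instance R V C) (sigma : seq (V * V)) : Prop :=
  swap_sequence I sigma /\ forall v, tcol I (run 1%g sigma v) = vcol I v.

(* The uncoloured instance defined by T : the token t must reach T t. *)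
Definition solves_uncoloured (R : realFieldType) (V C : finType)
    (I : instance R V C) (T : V -> V) (sigma : seq (V * V)) : Prop :=
  swap_sequence I sigma /\ forall v, T (run 1%g sigma v) = v.

Definition is_minimum (R : realFieldType) (A : R -> Prop) (m : R) : Prop :=
  A m /\ forall x, A x -> m <= x.

Definition min_cost (R : realFieldType) (V C : finType) (I : instance R V C)
    (solves : seq (V * V) -> Prop) (m : R) : Prop :=
  is_minimum (fun x => exists2 sigma, solves sigma & cost I sigma = x) m.

Definition optimal (R : realFieldType) (V C : finType) (I : instance R V C)
    (solves : seq (V * V) -> Prop) (sigma : seq (V * V)) : Prop :=
  solves sigma /\ forall sigma', solves sigma' -> cost I sigma <= cost I sigma'.

Definition token_vertex_assignment (R : realFieldType) (V C : finType)
    (I : instance R V C) (T : V -> V) : Prop :=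
  bijective T /\ forall t, vcol I (T t) = tcol I t.

(* [Fcost I T x] reads F(T) = x; a minimum is unique when it exists. *)
Definition Fcost (R : realFieldType) (V C : finType) (I : instance R V C)
    (T : V -> V) (x : R) : Prop := min_cost I (solves_uncoloured I T) x.

(** * The multigraph G and the assignment T_A *)

(* The edges of G are labelled by the vertices of the star: the edge labelled v
   goes from the colour [vcol I v] to the colour [tcol I v]. *)
Definition leaf_loop (R : realFieldType) (V C : finType) (I : instance R V C)
    (v : V) : bool := leaf (adj I) v && (vcol I v == tcol I v).

Definition G'_edges (R : realFieldType) (V C : finType) (I : instance R V C) :
  {set V} := [set v | ~~ leaf_loop I v].

Definition G'_adj (R : realFieldType) (V C : finType) (I : instance R V C) :
    rel C := fun c d =>
  [exists v in G'_edges I, ((vcol I v == c) && (tcol I v == d))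
                        || ((vcol I v == d) && (tcol I v == c))].

Definition G'_component (R : realFieldType) (V C : finType)
    (I : instance R V C) (c : C) : {set C} := [set d | connect (G'_adj I) c d].

Definition eulerian_circuit (R : realFieldType) (V C : finType)
    (I : instance R V C) (K : {set C}) (s : seq V) : Prop :=
  [/\ uniq s, s =i [set v in G'_edges I | vcol I v \in K]
    & path.cycle (fun v w => tcol I v == vcol I w) s].

(* T is a possible value of T_A.  Components are quantified through their
   elements; a component without edges has the empty circuit.  [next] is cyclic
   and, s being duplicate-free, maps v_i to v_(i+1). *)
Definition is_TA (R : realFieldType) (V C : finType) (I : instance R V C)
    (T : V -> V) : Prop :=
  (forall v, leaf_loop I v -> T v = v) /\
  (forall c, exists2 s, eulerian_circuit I (G'_component I c) s
                      & forall v, v \in s -> T v = next s v).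

(** * Polynomial time *)

(* Programs are systems of mutually recursive first-order functions over binary
   trees (the language F of N. D. Jones, "Computability and Complexity from a
   Programming Perspective"), where trees may also have weights as atoms.  Every
   elementary operation takes one unit of time.  The arithmetic is limited to
   addition, subtraction and comparison: without multiplication, t steps
   increase the bit length of the numbers by at most O(t), so that a polynomial
   bound on the number of steps gives polynomial time on a Turing machine when
   the weights are rationals written in binary. *)
Inductive data (R : Type) :=
  | DNil
  | DNum of R
  | DPair of data R & data R.

Arguments DNil {R}.

Inductive expr :=
  | EVar of nat
  | ENil
  | EPair of expr & expr
  | EFst of expr
  | ESnd of expr
  | EAdd of expr & expr
  | ESub of expr & expr
  | ELe of expr & expr
  | EIf of expr & expr & expr
  | ELet of expr & expr
  | ECall of nat & expr.

(* The i-th item is the body of function i, whose argument is variable 0. *)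
Definition program := seq expr.

Definition dfst (R : Type) (x : data R) : data R :=
  if x is DPair a _ then a else DNil.

Definition dsnd (R : Type) (x : data R) : data R :=
  if x is DPair _ b then b else DNil.

Definition dtrue (R : Type) (x : data R) : bool :=
  if x is DNil then false else true.

Definition dbool (R : Type) (b : bool) : data R :=
  if b then DPair DNil DNil else DNil.

Definition dadd (R : realFieldType) (x y : data R) : data R :=
  match x, y with DNum a, DNum b => DNum (a + b) | _, _ => DNil end.

Definition dsub (R : realFieldType) (x y : data R) : data R :=
  match x, y with DNum a, DNum b => DNum (a - b) | _, _ => DNil end.

Definition dle (R : realFieldType) (x y : data R) : data R :=
  match x, y with DNum a, DNum b => dbool R (a <= b) | _, _ => DNil end.

(* [eval p env e x t] : in the program p and the environment env (variables are
   de Bruijn indices), e evaluates to x in time t. *)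
Inductive eval (R : realFieldType) (p : program) :
    seq (data R) -> expr -> data R -> nat -> Prop :=
  | eval_var env i : eval p env (EVar i) (nth DNil env i) 1%N
  | eval_nil env : eval p env ENil DNil 1%N
  | eval_pair env e1 e2 x1 x2 t1 t2 :
      eval p env e1 x1 t1 -> eval p env e2 x2 t2 ->
      eval p env (EPair e1 e2) (DPair x1 x2) (t1 + t2)%N.+1
  | eval_fst env e x t :
      eval p env e x t -> eval p env (EFst e) (dfst x) t.+1
  | eval_snd env e x t :
      eval p env e x t -> eval p env (ESnd e) (dsnd x) t.+1
  | eval_add env e1 e2 x1 x2 t1 t2 :
      eval p env e1 x1 t1 -> eval p env e2 x2 t2 ->
      eval p env (EAdd e1 e2) (dadd x1 x2) (t1 + t2)%N.+1
  | eval_sub env e1 e2 x1 x2 t1 t2 :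
      eval p env e1 x1 t1 -> eval p env e2 x2 t2 ->
      eval p env (ESub e1 e2) (dsub x1 x2) (t1 + t2)%N.+1
  | eval_le env e1 e2 x1 x2 t1 t2 :
      eval p env e1 x1 t1 -> eval p env e2 x2 t2 ->
      eval p env (ELe e1 e2) (dle x1 x2) (t1 + t2)%N.+1
  | eval_if env e1 e2 e3 x1 x t1 t :
      eval p env e1 x1 t1 -> eval p env (if dtrue x1 then e2 else e3) x t ->
      eval p env (EIf e1 e2 e3) x (t1 + t)%N.+1
  | eval_let env e1 e2 x1 x t1 t :
      eval p env e1 x1 t1 -> eval p (x1 :: env) e2 x t ->
      eval p env (ELet e1 e2) x (t1 + t)%N.+1
  | eval_call env f e x1 x t1 t :
      eval p env e x1 t1 -> eval p [:: x1] (nth ENil p f) x t ->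
      eval p env (ECall f e) x (t1 + t)%N.+1.

Definition computes (R : realFieldType) (p : program) (x y : data R)
    (t : nat) : Prop := eval p [:: x] (nth ENil p 0%N) y t.

Definition enc_nat (R : Type) (n : nat) : data R :=
  iter n (DPair DNil) DNil.

Definition enc_seq (R : Type) (s : seq (data R)) : data R :=
  foldr (@DPair R) DNil s.

Definition enc_elt (R : Type) (X : finType) (x : X) : data R :=
  enc_nat R (enum_rank x).

(* A star is determined by its vertices and its centre, so its edges need not be
   part of the input. *)
Definition enc_instance (R : realFieldType) (V C : finType)
    (I : instance R V C) : data R :=
  DPair (enc_elt R (centre I))
    (DPair (enc_seq [seq DPair (enc_elt R (vcol I v)) (enc_elt R (tcol I v))
                    | v <- enum V])
           (enc_seq [seq DNum (weight I c) | c <- enum C])).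

Definition enc_swaps (R : Type) (V : finType) (sigma : seq (V * V)) : data R :=
  enc_seq [seq DPair (enc_elt R e.1) (enc_elt R e.2) | e <- sigma].

(* The time is bounded in terms of the numbers of vertices and of colours, not
   of the weights. *)
Definition polynomial_time_solvable : Prop :=
  exists (p : program) (k : nat),
  forall (R : realFieldType) (V C : finType) (I : instance R V C),
  star_instance I ->
  exists (sigma : seq (V * V)) (t : nat),
    [/\ optimal I (solves_coloured I) sigma,
        computes p (enc_instance I) (enc_swaps R sigma) t
      & (t <= k * (#|V| + #|C|) ^ k + k)%N].

(* Main.v *)
Require Import Defs.
From HB Require Import structures.
From mathcomp Require Import all_boot all_order all_algebra all_fingroup.
From mathcomp Require Import ring lra zify.

(** Every swap exchanges the token of the centre with a token of a leaf, so that
    the cost is, up to a constant, twice the total weight of the tokens that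
    arrive at the centre.  Each misplaced leaf token arrives at least once.  The
    first swap with a leaf of a component of G' other than that of the centre
    leaves a foreign token there, which must arrive once more; if k components
    are to be opened, these additional arrivals weigh at least the minimum of
    k m, m + (k - 1) g and m + (k + 1) f, where m, g, f are the least weights
    of a token in the component of the centre, in the other components, and on a
    leaf loop.  Only the components of G' enter this bound, and it is attained
    as soon as each component is a single cycle: solve the cycle of the centre
    and, when its lightest token is at the centre, solve the other cycles,
    either directly or from a lighter token fetched from another cycle or from
    a leaf loop.  The polynomial-time program computes Eulerian circuits with
    Hierholzer's algorithm and then the swaps just described. *)

Set Implicit Arguments.
Unset Strict Implicit.
Unset Printing Implicit Defensive.

Import Order.TTheory GRing.Theory Num.Theory.
Local Open Scope ring_scope.

(** * Swaps on a star *)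

Section Star.

Variables (V : finType) (e : rel V).

Lemma leafP x : reflect (exists y, e x =1 pred1 y) (leaf e x).
Proof.
apply: (iffP cards1P) => -[y xE]; exists y; last by apply/setP => z; rewrite !inE xE.
by move=> z; have /setP/(_ z) := xE; rewrite !inE.
Qed.

Variable u : V.
Hypothesis star_e : is_star e u.

Lemma star_leafE v : leaf e v = (v != u).
Proof. by case: star_e => _ leafE; rewrite -leafE negbK. Qed.

(* Two adjacent leaves would form a connected component. *)
Lemma star_adj_centre x : x != u -> e x u.
Proof.
case: star_e => -[sym _ conn _] _ xu.
have /leafP[y xE] : leaf e x by rewrite star_leafE.
have [<-|yu] := eqVneq y u; first by rewrite xE /= eqxx.
have /leafP[z yE] : leaf e y by rewrite star_leafE.
have {z yE} yE : e y =1 pred1 x.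
  by have := xE y; rewrite sym yE /= eqxx => /eqP->.
have pair_closed : closed e (mem [:: x; y]).
  apply: intro_closed; first exact: sym_connect_sym.
  move=> a b eab; rewrite !inE => /orP[]/eqP ?; subst a.
    by move: eab; rewrite xE /= => ->; rewrite orbT.
  by move: eab; rewrite yE /= => ->.
have := closed_connect pair_closed (conn x u).
by rewrite !inE eqxx !(eq_sym u) (negPf xu) (negPf yu).
Qed.

Lemma star_adjE x y : e x y = (x != y) && ((x == u) || (y == u)).
Proof.
case: (star_e) => -[sym irr _ _] _.
have [->|xy] /= := eqVneq x y; first exact: irr.
have [xu|xu] /= := eqVneq x u; first by rewrite xu sym star_adj_centre // -xu eq_sym.
have /leafP[z xE] : leaf e x by rewrite star_leafE.
by have := star_adj_centre xu; rewrite !xE /= => /eqP <-.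
Qed.

End Star.

Definition centre_swaps (V : finType) (u : V) (ls : seq V) : seq (V * V) :=
  [seq (u, l) | l <- ls].

Definition centre_run (V : finType) (u : V) (ls : seq V) : {perm V} :=
  run 1%g (centre_swaps u ls).

(* The total weight of the tokens that arrive at the centre, which determines the
   cost: see [cost_from_centre_swaps]. *)
Fixpoint arrivals (M : nmodType) (V : finType) (wt : V -> M) (u : V)
    (s : {perm V}) (ls : seq V) : M :=
  if ls is l :: ls' then wt (s l) + arrivals wt u (swap u l s) ls' else 0.

Section Runs.

Variable V : finType.
Implicit Types (u : V) (s : {perm V}) (sigma : seq (V * V)) (ls : seq V).

Lemma run_cat s sigma sigma' : run s (sigma ++ sigma') = run (run s sigma) sigma'.
Proof. by elim: sigma s => //= e sigma IH s. Qed.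

Lemma run_mulg s sigma : run s sigma = (run 1 sigma * s)%g.
Proof.
elim: sigma s => [|e sigma IH] s /=; first by rewrite mul1g.
by rewrite IH [run (swap _ _ 1%g) _]IH /swap mulg1 mulgA.
Qed.

Lemma centre_run_cons u l ls : centre_run u (l :: ls) = (centre_run u ls * tperm u l)%g.
Proof. by rewrite /centre_run /= run_mulg /swap mulg1. Qed.

Lemma centre_run_cat u a b : centre_run u (a ++ b) = (centre_run u b * centre_run u a)%g.
Proof. by rewrite /centre_run /centre_swaps map_cat run_cat run_mulg. Qed.

Lemma arrivals_cat (M : nmodType) (wt : V -> M) u s a b :
  arrivals wt u s (a ++ b) = arrivals wt u s a + arrivals wt u (centre_run u a * s)%g b.
Proof.
elim: a s => [|l a IH] s /=; first by rewrite add0r mul1g.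
by rewrite IH addrA centre_run_cons -mulgA.
Qed.

Lemma centre_run_surj u (p : {perm V}) : exists2 ls, u \notin ls & centre_run u ls = p.
Proof.
have : p \in <<[set tperm u y | y in V]>>%g by rewrite gen_tperm inE.
case/gen_prodgP=> n [c cP ->] {p}.
elim: n c cP => [|n IH] c cP; first by exists [::]; rewrite //= big_ord0.
rewrite big_ord_recr /=.
have [ls uls <-] := IH (fun i => c (widen_ord (leqnSn n) i)) (fun i => cP _).
have /imsetP[y _ ->] := cP ord_max.
have [<-|uy] := eqVneq u y; first by exists ls => //; rewrite tperm1 mulg1.
by exists (y :: ls); rewrite ?inE ?negb_or ?uy // centre_run_cons.
Qed.

End Runs.

Definition token_weight (R : realFieldType) (V C : finType) (I : instance R V C)
    (t : V) : R := weight I (tcol I t).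

Section StarInstance.

Variables (R : realFieldType) (V C : finType) (I : instance R V C).
Hypothesis starI : star_instance I.

Local Notation u := (centre I).
Local Notation wt := (token_weight I).

Lemma adjE x y : adj I x y = (x != y) && ((x == u) || (y == u)).
Proof. by case: starI => star _ _; apply: star_adjE. Qed.

Lemma leafE v : leaf (adj I) v = (v != u).
Proof. by case: starI => star _ _; apply: star_leafE. Qed.

Lemma token_weight_gt0 t : 0 < wt t.
Proof. by case: starI => _ _; apply. Qed.

Lemma cost_from_centre_swaps (s : {perm V}) (ls : seq V) :
  cost_from I s (centre_swaps u ls) =
  2 * arrivals wt u s ls + wt (s u) - wt (s (centre_run u ls u)).
Proof.
elim: ls s => [|l ls IH] s /=; first by rewrite perm1; ring.
by rewrite IH centre_run_cons !permM tpermL -!/(token_weight I _); ring.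
Qed.

Lemma swap_sequence_centre_swaps (ls : seq V) :
  swap_sequence I (centre_swaps u ls) = (u \notin ls).
Proof.
rewrite /swap_sequence all_map; elim: ls => //= l ls ->.
by rewrite inE negb_or adjE eqxx andbT.
Qed.

Lemma swap_sequence_of_centre_swaps (sigma : seq (V * V)) : swap_sequence I sigma ->
  exists ls : seq V, [/\ u \notin ls, run 1%g sigma = centre_run u ls
    & forall s, cost_from I s sigma = cost_from I s (centre_swaps u ls)].
Proof.
elim: sigma => [|[x y] sigma IH] /=; first by exists [::].
move=> /andP[]; rewrite adjE /= => /andP[xy xyu] /IH[ls [uls runE costE]].
have [l [lu swapE addE]] : exists l, [/\ u != l, swap x y = swap u l
    & forall s, wt (s x) + wt (s y) = wt (s u) + wt (s l)].
  case/orP: xyu => /eqP xyu; first by exists y; rewrite -xyu.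
  exists x; split=> [||s]; rewrite -?xyu 1?eq_sym //; last by rewrite addrC.
  by rewrite /swap tpermC.
exists (l :: ls); split; first by rewrite inE negb_or lu.
  by rewrite run_mulg runE centre_run_cons swapE /swap mulg1.
by move=> s /=; rewrite costE swapE addE.
Qed.

End StarInstance.

(** * The lower bound *)

Section LowerBound.

Variables (R : realFieldType) (V C : finType) (I : instance R V C).
Hypothesis starI : star_instance I.

Local Notation u := (centre I).
Local Notation wt := (token_weight I).

Variables (L : finType) (label : C -> L) (nontrivial : pred L) (extra : {set L} -> R).

Hypothesis label_edge : forall v, label (vcol I v) = label (tcol I v).
Hypothesis nontrivial_misplaced : forall X, nontrivial X ->
  exists v, [/\ v != u, vcol I v != tcol I v & label (vcol I v) = X].
Hypothesis trivial_placed : forall v, v != u -> ~~ nontrivial (label (vcol I v)) ->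
  label (vcol I v) != label (vcol I u) -> vcol I v = tcol I v.

(* O is the set of the labels met so far.  The first swap with a leaf l of a new
   label leaves a foreign token x there, which has to come back later. *)
Hypothesis extra_step : forall (O : {set L}) (x l : V),
  label (vcol I u) \in O -> label (vcol I x) \in O -> label (vcol I l) \notin O ->
  extra O <= extra (label (vcol I l) |: O) + wt x
             + (if nontrivial (label (vcol I l)) then 0 else wt l).
Hypothesis extra_end : forall O : {set L},
  (forall X, nontrivial X -> X \in O) -> extra O <= 0.

Definition misplaced_at (s : {perm V}) (l : V) : R :=
  if tcol I (s l) == vcol I l then 0 else wt (s l).

Definition misplaced_weight (s : {perm V}) : R := \sum_(l | l != u) misplaced_at s l.

Lemma misplaced_weight_swap (s : {perm V}) l : l != u ->
  misplaced_weight s - misplaced_at s l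
  = misplaced_weight (swap u l s) - misplaced_at (swap u l s) l.
Proof.
move=> lu; rewrite /misplaced_weight !(bigD1 (P := fun i => i != u) l) //=.
rewrite ![_ + _ - _]addrAC !subrr !add0r.
by apply: eq_bigr => i /andP[iu il]; rewrite /misplaced_at permM tpermD // eq_sym.
Qed.

Definition potential (s : {perm V}) (O : {set L}) : R := misplaced_weight s + extra O.

Lemma potential_swap (s : {perm V}) (O : {set L}) l :
  l != u -> label (vcol I u) \in O ->
  (forall v, label (vcol I v) \notin O -> s v = v) ->
  potential s O <= wt (s l) + potential (swap u l s) (label (vcol I l) |: O).
Proof.
move=> lu uO fixs; rewrite /potential; set X := label (vcol I l).
have := misplaced_weight_swap s lu.
rewrite {2}/misplaced_at permM tpermR {1}/misplaced_at.
have wsl := token_weight_gt0 starI (s l).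
have wsu := token_weight_gt0 starI (s u).
have [XO|XO] := boolP (X \in O).
  by rewrite (setUidPr _) ?sub1set //; case: ifP; case: ifP; lra.
have suO : label (vcol I (s u)) \in O.
  by apply: contraLR uO => suO; rewrite -(perm_inj (fixs _ suO)).
have /negPf -> : tcol I (s u) != vcol I l.
  by apply: contraNneq XO => suE; rewrite /X -suE -label_edge.
have sl : s l = l := fixs _ XO.
have := extra_step uO suO XO; rewrite sl -/X in wsl *.
have [nX|tX] := boolP (nontrivial X); first by case: ifP; lra.
rewrite -[tcol I l]trivial_placed ?eqxx //; first lra.
by apply: contraNneq XO => XE; rewrite /X XE.
Qed.

Lemma arrivals_ge_potential (s : {perm V}) (O : {set L}) (ls : seq V) :
  u \notin ls -> label (vcol I u) \in O ->
  (forall v, label (vcol I v) \notin O -> s v = v) ->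
  (forall v, tcol I (s (centre_run u ls v)) = vcol I v) ->
  potential s O <= arrivals wt u s ls.
Proof.
elim: ls s O => [|l ls IH] s O /=.
  move=> _ uO fixs sol; rewrite /potential /misplaced_weight big1 ?add0r => [|v _].
    apply: extra_end => // X /nontrivial_misplaced[v [vu vt <-]].
    by apply: contraNT vt => /fixs sv; rewrite -(sol v) perm1 sv.
  by rewrite /misplaced_at -[vcol I v]sol perm1 eqxx.
rewrite inE negb_or => /andP[ul uls] uO fixs sol.
have lu : l != u by rewrite eq_sym.
apply: le_trans (potential_swap lu uO fixs) _.
rewrite lerD2l; apply: IH => // [|v|v]; first by rewrite setU1r.
- rewrite in_setU1 negb_or => /andP[vl vO].
  rewrite permM tpermD ?fixs //; first by apply: contraNneq vO => <-.
  by apply: contraNneq vl => <-.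
- by rewrite -sol centre_run_cons !permM.
Qed.

End LowerBound.

(** * Eulerian circuits *)

Section Euler.

Variables (V C : eqType) (src tgt : V -> C).

Implicit Types (b v w : V) (c : C) (s stack out rest : seq V).

Definition follows : rel V := fun v w => tgt v == src w.

Definition balanced s : Prop :=
  forall c, count (fun v => src v == c) s = count (fun v => tgt v == c) s.

Lemma perm_balanced s s' : perm_eq s s' -> balanced s -> balanced s'.
Proof. by move=> /seq.permP ss' bs c; rewrite -!ss'. Qed.

Lemma balanced_catr s s' : balanced s -> balanced (s ++ s') -> balanced s'.
Proof. by move=> bs bss c; have := bss c; have := bs c; rewrite !count_cat; lia. Qed.

Lemma trail_count s v c : sorted follows (rcons s v) ->
  (count (fun w => src w == c) s + (src v == c)
   = count (fun w => tgt w == c) s + (src (head v s) == c))%N.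
Proof.
elim: s => [|w s IH] //=.
case: s IH => [_ /andP[/eqP -> _]|w' s IH /= /andP[/eqP wE /IH]] /=; first by lia.
by rewrite wE /=; lia.
Qed.

Lemma cycle_balanced s : path.cycle follows s -> balanced s.
Proof. by case: s => [|v s] //= /(@trail_count (v :: s)) cnt c; have := cnt c; rewrite /=; lia. Qed.

Fixpoint extract c rest : option (V * seq V) :=
  if rest is w :: rest' then
    if c == src w then Some (w, rest')
    else if extract c rest' is Some (w', r) then Some (w', w :: r) else None
  else None.

Variant extract_spec c rest : option (V * seq V) -> Prop :=
  | ExtractSome w r of src w = c & perm_eq (w :: r) rest
    : extract_spec c rest (Some (w, r))
  | ExtractNone of (forall w, w \in rest -> src w != c)
    : extract_spec c rest None.

Lemma extractP c rest : extract_spec c rest (extract c rest).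
Proof.
elim: rest => /= [|w rest IH]; first exact: ExtractNone.
case: (eqVneq c (src w)) => [->|cw]; first exact: ExtractSome.
case: IH => [w' r sw' pr|no].
  apply: ExtractSome => //; rewrite (perm_catCA [:: w'] [:: w]) /= perm_cons.
  exact: pr.
by apply: ExtractNone => w'; rewrite inE => /predU1P[->|/no //]; rewrite eq_sym.
Qed.

(* Hierholzer's algorithm: [stack] is a trail in reverse order, extended at its
   head while possible; an edge that cannot be extended moves to [out]. *)
Fixpoint hierholzer (n : nat) stack out rest : seq V * seq V :=
  if n is n'.+1 then
    if stack is v :: stack' then
      if extract (tgt v) rest is Some (w, r)
      then hierholzer n' (w :: stack) out r
      else hierholzer n' stack' (v :: out) rest
    else (out, rest)
  else (out, rest).

(* [rcons out b] is a trail exactly when [out] is a trail that ends at the source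
   of b. *)
Record hierholzer_invariant b stack out rest : Prop := HierholzerInvariant {
  invariant_balanced : balanced (stack ++ out ++ rest);
  invariant_start : ohead (rev stack ++ out) = Some b;
  invariant_stack : sorted follows (rev stack);
  invariant_out : sorted follows (rcons out b);
  invariant_exhausted : {in out & rest, forall v w, tgt v != src w}
}.

Lemma hierholzer_push b v w stack out rest rest' :
  follows v w -> perm_eq (w :: rest') rest ->
  hierholzer_invariant b (v :: stack) out rest ->
  hierholzer_invariant b [:: w, v & stack] out rest'.
Proof.
move=> vw pr [bal start trail trail_out exh]; split=> //.
- apply: perm_balanced bal; apply/seq.permP => a.
  by move/seq.permP/(_ a): pr; rewrite /= !count_cat /=; lia.
- by move: start; rewrite !rev_cons !cat_rcons; case: rev.
- by move: trail; rewrite !rev_cons -[rcons (rcons _ _) _]cats1 cat_rcons sorted_cat_cons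
    => -> /=; rewrite vw.
- by move=> x y xo yr; apply: exh => //; rewrite -(perm_mem pr) inE yr orbT.
Qed.

(* If no remaining edge leaves the target c of v, balance at c forces the trail
   [out], or b when it is empty, to start at c. *)
Lemma hierholzer_stuck b v stack out rest :
  {in rest, forall w, src w != tgt v} ->
  hierholzer_invariant b (v :: stack) out rest -> tgt v = src (head b out).
Proof.
move=> stuck [bal start trail trail_out _].
have rest0 : count (fun w => src w == tgt v) rest = 0%N.
  by apply/eqP; rewrite -leqn0 leqNgt -has_count; apply/hasP => -[w /stuck /negPf ->].
have startE : head v (rev stack) = b.
  by move: start; rewrite rev_cons cat_rcons; case: (rev stack) => [|x s] [].
apply/esym/eqP/contraT => /negPf open_trail.
have := trail_count (tgt v) trail_out.
have := bal (tgt v); rewrite /= !count_cat rest0.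
move: trail; rewrite rev_cons => /(@trail_count _ _ (tgt v)).
by rewrite startE !count_rev eqxx open_trail; lia.
Qed.

Lemma hierholzer_pop b v stack out rest :
  {in rest, forall w, src w != tgt v} ->
  hierholzer_invariant b (v :: stack) out rest ->
  hierholzer_invariant b stack (v :: out) rest.
Proof.
move=> stuck inv; have close := hierholzer_stuck stuck inv.
case: inv => [bal start trail trail_out exh]; split.
- by apply: perm_balanced bal; rewrite perm_sym -(cat1s v out) -catA perm_catCA.
- by move: start; rewrite rev_cons cat_rcons.
- by move: trail; rewrite rev_cons -cats1 => /cat_sorted2[].
- rewrite /=; case: (out) close trail_out => [|x o] /= close; first by rewrite /follows close eqxx.
  by move=> ->; rewrite /follows close eqxx.
- move=> x w; rewrite inE => /predU1P[->|]; last exact: exh.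
  by move=> /stuck; rewrite eq_sym.
Qed.

Lemma hierholzerP n b stack out rest :
  ((size rest).*2 + size stack < n)%N ->
  hierholzer_invariant b stack out rest ->
  let: (circ, rest') := hierholzer n stack out rest in
  hierholzer_invariant b [::] circ rest'
  /\ perm_eq (circ ++ rest') (stack ++ out ++ rest).
Proof.
elim: n stack out rest => [|n IH] [|v stack] out rest //= size_lt inv.
case: extractP => [w r wE pr|stuck].
  have := IH [:: w, v & stack] out r; case: hierholzer => circ rest' /=.
  case=> [||inv' perm']; last 1 first.
  - split=> //; apply: perm_trans perm' _.
    apply/seq.permP => a; move/seq.permP/(_ a): pr.
    by rewrite /= !count_cat /=; lia.
  - by have := perm_size pr => /= sr; lia.
  - by apply: hierholzer_push inv => //; rewrite /follows wE.
have := IH stack (v :: out) rest; case: hierholzer => circ rest' /=.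
case=> [||inv' perm']; last 1 first.
- by split=> //; apply: perm_trans perm' _; rewrite -cat1s perm_catCA.
- lia.
- exact: hierholzer_pop.
Qed.

Definition euler_from b rest : seq V * seq V :=
  hierholzer (size rest).*2.+2 [:: b] [::] rest.

Definition src_disjoint : rel (seq V) := allrel (fun v w => src v != src w).

Lemma uniq_flatten_src_disjoint (Ks : seq (seq V)) : all uniq Ks ->
  pairwise src_disjoint Ks -> uniq (flatten Ks).
Proof.
elim: Ks => //= K Ks IH /andP[uqK uqKs] /andP[/allP disjK disjKs].
rewrite cat_uniq uqK IH // andbT /=; apply/hasP => -[v /flattenP[K' K'in vK'] vK].
by have /allrelP/(_ _ _ vK vK') := disjK _ K'in; rewrite eqxx.
Qed.

Lemma euler_fromP b rest : balanced (b :: rest) ->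
  let: (circ, rest') := euler_from b rest in
  [/\ perm_eq (circ ++ rest') (b :: rest), ohead circ = Some b,
      path.cycle follows circ, balanced rest' & src_disjoint circ rest'].
Proof.
move=> bal; have inv : hierholzer_invariant b [:: b] [::] rest by split.
have fuel : ((size rest).*2 + size [:: b] < (size rest).*2.+2)%N by rewrite addn1.
have := hierholzerP fuel inv; rewrite -/(euler_from b rest).
case: euler_from => circ rest' [[bal' start _ trail exh] perm_circ].
have cyc : path.cycle follows circ by case: (circ) start trail => //= v s [->].
split=> //; first exact: balanced_catr (cycle_balanced cyc) bal'.
apply/allrelP => v w vc wr; have /eqP <- := prev_cycle cyc vc.
by apply: exh; rewrite ?mem_prev.
Qed.

Fixpoint circuits (n : nat) rest : seq (seq V) :=
  if n is n'.+1 then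
    if rest is b :: rest' then
      (euler_from b rest').1 :: circuits n' (euler_from b rest').2
    else [::]
  else [::].

Lemma circuitsP n rest : (size rest <= n)%N -> balanced rest ->
  [/\ perm_eq (flatten (circuits n rest)) rest,
      all (fun K => K != [::]) (circuits n rest),
      all (path.cycle follows) (circuits n rest)
    & pairwise src_disjoint (circuits n rest)].
Proof.
elim: n rest => [|n IH] [|b rest] //= size_le bal.
have := euler_fromP bal; case: euler_from => circ rest' /= [perm_circ start cyc bal' disj].
have circ0 : circ != [::] by apply: contra_eq_neq start => ->.
have size_rest' : (size rest' <= n)%N.
  move/perm_size: perm_circ; rewrite size_cat /= => sizeE.
  by move: circ0; rewrite -size_eq0; lia.
have [perm_flat nonempty cycles disjoint] := IH _ size_rest' bal'.
split; rewrite ?circ0 ?cyc //=; first by rewrite -(permPr perm_circ) perm_cat2l.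
rewrite disjoint andbT; apply/allP => K Kin; apply/allrelP => v w vc wK.
apply: (allrelP disj) => //; rewrite -(perm_mem perm_flat).
by apply/flattenP; exists K.
Qed.

End Euler.

(** * Solving circuits one inside the other *)

Section UniqSeq.

Variable T : eqType.
Implicit Types (x y : T) (s t : seq T).

Lemma uniq_cat_notinl s t : uniq (s ++ t) -> {in s, forall x, x \notin t}.
Proof.
rewrite cat_uniq => /and3P[_ /hasPn disj _] x xs.
by apply/negP => /disj; rewrite /= xs.
Qed.

Lemma uniq_cat_notinr s t : uniq (s ++ t) -> {in t, forall x, x \notin s}.
Proof. by rewrite uniq_catC; apply: uniq_cat_notinl. Qed.

Lemma uniq_cons_cat x s t : uniq (x :: s ++ t) -> uniq (x :: s) /\ uniq (x :: t).
Proof.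
by rewrite /= mem_cat negb_or cat_uniq => /andP[/andP[-> ->] /and3P[-> _ ->]].
Qed.

Lemma prev_notin s x : x \notin s -> prev s x = x.
Proof. by move=> xs; rewrite prev_nth (negPf xs). Qed.

Definition prevs (Ks : seq (seq T)) x : T := foldr (fun K => prev K) x Ks.

Lemma prevs_notin Ks x : x \notin flatten Ks -> prevs Ks x = x.
Proof.
elim: Ks => //= K Ks IH; rewrite mem_cat negb_or => /andP[xK /IH ->].
exact: prev_notin.
Qed.

Lemma prevs_in Ks K x : uniq (flatten Ks) -> K \in Ks -> x \in K ->
  prevs Ks x = prev K x.
Proof.
elim: Ks => //= K' Ks IH uq; have uqs : uniq (flatten Ks).
  by move: uq; rewrite cat_uniq => /and3P[].
rewrite inE => /predU1P[-> xK'|Kin xK].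
  by rewrite prevs_notin // (uniq_cat_notinl uq).
rewrite IH // prev_notin // (uniq_cat_notinr uq) //.
by apply/flattenP; exists K => //; rewrite mem_prev.
Qed.

Lemma perm_prevs Ks Ks' : perm_eq Ks Ks' -> uniq (flatten Ks) -> prevs Ks =1 prevs Ks'.
Proof.
move=> permK uq x; have perm_flat := perm_flatten permK.
have [/flattenP[K Kin xK]|xKs] := boolP (x \in flatten Ks); last first.
  by rewrite !prevs_notin // -(perm_mem perm_flat).
by rewrite (prevs_in uq Kin xK) (prevs_in _ _ xK) // -?(perm_uniq perm_flat) -?(perm_mem permK).
Qed.

End UniqSeq.

Lemma prev_rcons (T : finType) (x y : T) s v : uniq (x :: rcons s y) ->
  prev (x :: rcons s y) v = prev (x :: s) (tperm x y v).
Proof.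
rewrite -[in uniq _]rcons_cons rcons_uniq cons_uniq inE negb_or.
move=> /and3P[/andP[yx ys] xs _].
case: tpermP => [->|->|/eqP vx /eqP vy].
- have -> : prev (x :: s) y = y by rewrite prev_notin // inE negb_or yx.
  rewrite prev_nth mem_head memNindex; last by rewrite mem_rcons inE negb_or eq_sym yx.
  by rewrite nth_last /= last_rcons.
- rewrite !prev_nth mem_head !inE mem_rcons mem_head orbT (memNindex xs).
  rewrite -cats1 index_cat (negPf ys) /= eqxx addn0.
  by rewrite -cat_cons nth_cat ltnSn.
- rewrite !prev_nth !inE mem_rcons inE (negPf vy) (negPf vx) /=.
  case: ifP => // vs; rewrite -cats1 index_cat vs -cat_cons nth_cat /=.
  by rewrite ltnS index_size.
Qed.

Record pivoted (T : Type) := Pivoted { before : seq T; pivot : T; after : seq T }.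

Section Pivoted.

Variable T : Type.
Implicit Types (K : pivoted T) (M : seq T) (Ks : seq (pivoted T)).

Definition glue K : seq T := before K ++ pivot K :: after K.

Definition entry K : T := head (pivot K) (before K).

(* The token at the pivot of K stays at the centre during the swaps M. *)
Definition insert_at K M : seq T := before K ++ pivot K :: M ++ after K.

(* The second swap with the entry brings the token of the centre back. *)
Definition excursion K M : seq T := rcons (insert_at K M) (entry K).

Definition excursions Ks : seq T := flatten [seq excursion K [::] | K <- Ks].

Definition glues Ks : seq T := flatten [seq glue K | K <- Ks].

Lemma glues_cons K Ks : glues (K :: Ks) = glue K ++ glues Ks.
Proof. by []. Qed.

Lemma glue_rcons K : rcons (before K) (pivot K) ++ after K = glue K.
Proof. by rewrite cat_rcons. Qed.

Lemma glue_entry K : glue K = entry K :: behead (glue K).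
Proof. by case: K => [[|x B] y A]. Qed.

Lemma insert_at_rcons K M : insert_at K M = rcons (before K) (pivot K) ++ M ++ after K.
Proof. by rewrite cat_rcons. Qed.

Lemma excursion_rcons K M :
  excursion K M = rcons (before K) (pivot K) ++ M ++ rcons (after K) (entry K).
Proof. by rewrite /excursion insert_at_rcons -!rcons_cat. Qed.

Lemma excursions_cons K Ks : excursions (K :: Ks) = excursion K [::] ++ excursions Ks.
Proof. by []. Qed.

End Pivoted.

Section MemPivoted.

Variable T : eqType.
Implicit Types (K : pivoted T) (M : seq T) (Ks : seq (pivoted T)).

Lemma mem_pivot K : pivot K \in glue K.
Proof. by rewrite mem_cat mem_head orbT. Qed.

Lemma mem_after K : {subset after K <= glue K}.
Proof. by move=> x xK; rewrite mem_cat inE xK !orbT. Qed.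

Lemma mem_entry K : entry K \in glue K.
Proof. by rewrite glue_entry mem_head. Qed.

Lemma mem_excursion K M : excursion K M =i glue K ++ M.
Proof.
move=> x; rewrite excursion_rcons -glue_rcons !mem_cat !mem_rcons !inE.
have [->|_] := eqVneq x (entry K); last by rewrite -!orbA (orbC (_ \in M)).
have := mem_entry K; rewrite -glue_rcons mem_cat mem_rcons inE => ->.
by rewrite !orbT.
Qed.

Lemma mem_excursions Ks : excursions Ks =i glues Ks.
Proof.
move=> x; elim: Ks => // K Ks IH.
by rewrite excursions_cons /= 2!mem_cat mem_excursion cats0 IH.
Qed.

End MemPivoted.

Section CentreRuns.

Variables (A : nmodType) (V : finType) (wt : V -> A) (u : V).

Implicit Types (s : {perm V}) (a b ls M : seq V) (K : pivoted V) (Ks : seq (pivoted V)).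

Lemma centre_run_trail ls : uniq (u :: ls) -> centre_run u ls =1 prev (u :: ls).
Proof.
elim/last_ind: ls => [|ls l IH] uq v; first by rewrite perm1 /=; case: eqP.
rewrite prev_rcons // -cats1 centre_run_cat permM centre_run_cons /centre_run.
rewrite mul1g IH //; move: uq; rewrite -rcons_cons rcons_uniq.
by case/andP.
Qed.

Lemma centre_run_notin ls v : v \notin u :: ls -> centre_run u ls v = v.
Proof.
elim: ls => [|l ls IH] /=; first by rewrite perm1.
rewrite !inE !negb_or => /and3P[vu vl vls].
by rewrite centre_run_cons permM IH ?inE ?negb_or ?vu // tpermD // eq_sym.
Qed.

Lemma centre_run_centre ls : uniq (u :: ls) -> centre_run u ls u = last u ls.
Proof.
move=> uq; rewrite centre_run_trail // prev_nth mem_head.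
by case/andP: uq => /memNindex -> _; rewrite nth_last.
Qed.

Lemma centre_run_closed_trail h ls : uniq (u :: h :: ls) ->
  centre_run u (rcons (h :: ls) h) =1 prev (h :: ls).
Proof.
move=> uq v; rewrite -cats1 centre_run_cat permM centre_run_trail //.
rewrite -(prev_rot 1) // rot1_cons prev_rcons; last by rewrite -rcons_cons -rot1_cons rot_uniq.
by rewrite centre_run_cons /centre_run mul1g tpermC tpermK.
Qed.

Lemma centre_run_commute s ls : {in u :: ls, s =1 id} -> commute s (centre_run u ls).
Proof.
elim: ls => [|l ls IH] fixs; first exact: commute1.
rewrite centre_run_cons; apply: commuteM.
  by apply: IH => x xls; apply: fixs; move: xls; rewrite !inE => /orP[]->; rewrite ?orbT.
by apply/commute_sym; rewrite /commute conjgC tpermJ !fixs // !inE eqxx ?orbT.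
Qed.

Lemma centre_run_insert a M b : {in u :: b, centre_run u M =1 id} ->
  centre_run u (a ++ M ++ b) = (centre_run u M * centre_run u (a ++ b))%g.
Proof. by move=> fixM; rewrite !centre_run_cat mulgA -(centre_run_commute fixM). Qed.

Lemma arrivals_trail s ls : uniq (u :: ls) ->
  arrivals wt u s ls = \sum_(l <- ls) wt (s l).
Proof.
elim: ls s => [|l ls IH] s /=; first by rewrite big_nil.
rewrite inE negb_or => /andP[/andP[ul uls] /andP[lls uq]].
rewrite big_cons IH /= ?uls //; congr (_ + _); apply: eq_big_seq => x xls.
rewrite permM tpermD //; first by apply: contraNneq uls => ->.
by apply: contraNneq lls => ->.
Qed.

Lemma arrivals_insert s a M b : uniq (u :: a ++ b) ->
  {in b, centre_run u M =1 id} ->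
  arrivals wt u s (a ++ M ++ b) =
  \sum_(l <- a ++ b) wt (s l) + arrivals wt u (centre_run u a * s)%g M.
Proof.
rewrite -cat_cons => uq fixM; have := uq; rewrite cat_uniq => /and3P[uqa _ uqb].
have uqb' : uniq (u :: b) by rewrite /= uqb (uniq_cat_notinl uq) ?mem_head.
rewrite !arrivals_cat big_cat /= arrivals_trail // (arrivals_trail _ uqb').
rewrite addrAC addrA; congr (_ + _ + _); apply: eq_big_seq => l lb.
by rewrite !permM fixM //= centre_run_notin // (uniq_cat_notinr uq).
Qed.

Lemma centre_run_excursion K M : uniq (u :: glue K) ->
  {in u :: glue K, centre_run u M =1 id} ->
  forall v, centre_run u (excursion K M) v = prev (glue K) (centre_run u M v).
Proof.
move=> uq fixM v; rewrite excursion_rcons centre_run_insert; last first.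
  move=> l; rewrite inE mem_rcons inE => /or3P[/eqP->|/eqP->|lK]; apply: fixM.
  - exact: mem_head.
  - by rewrite inE mem_entry orbT.
  - by rewrite inE mem_after ?orbT.
rewrite permM -rcons_cat glue_rcons; move: uq; rewrite glue_entry => uq.
by rewrite centre_run_closed_trail.
Qed.

Lemma arrivals_excursion s K M : uniq (u :: glue K) ->
  {in u :: glue K, centre_run u M =1 id} ->
  arrivals wt u s (excursion K M) = \sum_(l <- glue K) wt (s l) + wt (s u)
    + arrivals wt u (centre_run u (rcons (before K) (pivot K)) * s)%g M.
Proof.
move=> uq fixM; have fixA : {in u :: after K, centre_run u M =1 id}.
  move=> l; rewrite inE => /predU1P[->|lK]; apply: fixM; first exact: mem_head.
  by rewrite inE mem_after ?orbT.
rewrite /excursion -cats1 insert_at_rcons arrivals_cat arrivals_insert ?glue_rcons //.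
  rewrite addrAC /= addr0 centre_run_insert // glue_rcons !permM.
  rewrite fixM ?inE ?mem_entry ?orbT // centre_run_trail //.
  by rewrite glue_entry /= eqxx.
by move=> l lK; apply: fixA; rewrite inE lK orbT.
Qed.

Lemma centre_run_excursions Ks : uniq (u :: glues Ks) ->
  centre_run u (excursions Ks) =1 prevs (map (@glue V) Ks).
Proof.
elim: Ks => [_ v|K Ks IH]; first exact: perm1.
rewrite glues_cons => uq v; have [uqK uqKs] := uniq_cons_cat uq.
rewrite excursions_cons centre_run_cat permM IH // centre_run_excursion //.
  by rewrite /= perm1.
by move=> l _; apply: perm1.
Qed.

Lemma excursions_fix a Ks : uniq (u :: a ++ glues Ks) ->
  {in u :: a, centre_run u (excursions Ks) =1 id}.
Proof.
rewrite -cat_cons => uq l la; rewrite centre_run_excursions.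
  exact/prevs_notin/(uniq_cat_notinl uq).
have := uniq_cat_notinl uq (mem_head _ _).
by move: uq; rewrite cat_uniq /= => /and3P[_ _ ->] ->.
Qed.

Lemma arrivals_excursions s Ks : uniq (u :: glues Ks) ->
  arrivals wt u s (excursions Ks) = \sum_(l <- glues Ks) wt (s l) + wt (s u) *+ size Ks.
Proof.
elim: Ks s => [|K Ks IH] s; first by rewrite /= big_nil addr0.
rewrite glues_cons => uq; have [uqK uqKs] := uniq_cons_cat uq.
have fix0 : {in u :: glue K, centre_run u [::] =1 id} by move=> l _; apply: perm1.
rewrite excursions_cons arrivals_cat arrivals_excursion // IH // addr0.
rewrite (big_cat _ (glue K)) /= mulrS !permM centre_run_excursion //.
rewrite perm1 prev_notin; last by case/andP: uqK.
rewrite addrACA; congr (_ + _ + _); apply: eq_big_seq => l lKs.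
rewrite permM centre_run_notin // inE mem_excursion cats0 -in_cons.
by move: uq; rewrite -cat_cons => /uniq_cat_notinr ->.
Qed.

Lemma centre_run_nested K Ks : uniq (u :: glue K ++ glues Ks) ->
  centre_run u (excursion K (excursions Ks)) =1 prevs (map (@glue V) (K :: Ks)).
Proof.
move=> uq v; have [uqK uqKs] := uniq_cons_cat uq.
by rewrite centre_run_excursion ?centre_run_excursions //; apply: excursions_fix.
Qed.

Lemma arrivals_nested s K Ks : uniq (u :: glue K ++ glues Ks) ->
  arrivals wt u s (excursion K (excursions Ks)) =
  \sum_(l <- glue K ++ glues Ks) wt (s l) + wt (s u) + wt (s (pivot K)) *+ size Ks.
Proof.
move=> uq; have [uqK uqKs] := uniq_cons_cat uq.
rewrite arrivals_excursion ?arrivals_excursions //; last exact: excursions_fix.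
have uqB : uniq (u :: rcons (before K) (pivot K)).
  by move: uqK; rewrite -glue_rcons -cat_cons cat_uniq => /andP[].
rewrite permM centre_run_centre // last_rcons (big_cat _ (glue K)) /= addrA [X in X + _ = _]addrAC.
congr (_ + _ + _ + _); apply: eq_big_seq => l lKs; rewrite permM centre_run_notin //.
move: uq; rewrite -cat_cons => /uniq_cat_notinr/(_ l lKs); apply: contra.
by rewrite -glue_rcons !inE mem_cat => /orP[]->; rewrite ?orbT.
Qed.

End CentreRuns.

(** * Systems of circuits *)

Section PivotMin.

Variables (d : Order.disp_t) (R : orderType d).

Fixpoint pivot_min (T : Type) (key : T -> R) (x : T) (s : seq T) : pivoted T :=
  if s is y :: s' then
    let K := pivot_min key y s' in
    if (key x <= key (pivot K))%O then Pivoted [::] x s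
    else Pivoted (x :: before K) (pivot K) (after K)
  else Pivoted [::] x [::].

Lemma glue_pivot_min (T : Type) (key : T -> R) x s : glue (pivot_min key x s) = x :: s.
Proof. by elim: s x => //= y s IH x; case: ifP => //= _; rewrite -(IH y). Qed.

Lemma pivot_min_le (T : Type) (key : T -> R) x s :
  all (fun y => key (pivot (pivot_min key x s)) <= key y)%O (x :: s).
Proof.
elim: s x => [|y s IH] x; first by rewrite /= lexx.
have := IH y; rewrite [pivot_min key x _]/=; case: ifPn => /= [le_x|].
  move=> /andP[le_y all_s]; rewrite lexx (le_trans le_x le_y).
  by apply: sub_all all_s => z; apply: le_trans.
by rewrite -ltNge => /ltW -> ->.
Qed.

End PivotMin.

Record circuit_system (R : realFieldType) (V C : finType) (I : instance R V C)
    (K0 : seq V) (Ks : seq (seq V)) : Prop := CircuitSystem {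
  system_uniq : uniq (flatten (K0 :: Ks));
  mem_system : forall v, (v \in flatten (K0 :: Ks)) = ~~ leaf_loop I v;
  system_centre : K0 = centre I :: behead K0;
  system_nonempty : all (fun K => K != [::]) Ks;
  system_cycle : all (path.cycle (follows (vcol I) (tcol I))) (K0 :: Ks);
  system_disjoint : pairwise (src_disjoint (vcol I)) (K0 :: Ks)
}.

Section CircuitSystem.

Variables (R : realFieldType) (V C : finType) (I : instance R V C).
Variables (K0 : seq V) (Ks : seq (seq V)).
Hypothesis sysK : circuit_system I K0 Ks.

Local Notation u := (centre I).
Local Notation wt := (token_weight I).
Local Notation n := (size Ks).
Local Notation circ i := (nth [::] (K0 :: Ks) i).

Lemma system_mem K v : K \in K0 :: Ks -> v \in K -> ~~ leaf_loop I v.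
Proof. by move=> Kin vK; rewrite -(mem_system sysK); apply/flattenP; exists K. Qed.

Lemma circuit_uniq K : K \in K0 :: Ks -> uniq K.
Proof.
have := system_uniq sysK; elim: (K0 :: Ks) => //= K' L IH; rewrite cat_uniq.
by case/and3P=> uqK' _ uqL; rewrite inE => /predU1P[->|/IH] //; apply.
Qed.

Lemma centre_in : u \in K0.
Proof. by rewrite (system_centre sysK) mem_head. Qed.

Lemma others_notin_centre_circuit : {in flatten Ks, forall v, v \notin K0}.
Proof. exact: uniq_cat_notinr (system_uniq sysK). Qed.

Lemma others_uniq : uniq (u :: flatten Ks).
Proof.
have := system_uniq sysK; rewrite /= cat_uniq => /and3P[_ _ ->]; rewrite andbT.
exact: uniq_cat_notinl (system_uniq sysK) _ centre_in.
Qed.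

Lemma prevs_leaf_loop v : leaf_loop I v -> prevs (K0 :: Ks) v = v.
Proof. by move=> lv; rewrite prevs_notin // (mem_system sysK) negbK. Qed.

Lemma system_prevs v : ~~ leaf_loop I v ->
  exists K, [/\ K \in K0 :: Ks, v \in K & prevs (K0 :: Ks) v = prev K v].
Proof.
rewrite -(mem_system sysK) => /flattenP[K Kin vK].
by exists K; split=> //; apply: prevs_in (system_uniq sysK) Kin vK.
Qed.

Lemma tcol_prevs v : tcol I (prevs (K0 :: Ks) v) = vcol I v.
Proof.
have [lv|/system_prevs[K [Kin vK ->]]] := boolP (leaf_loop I v).
  by rewrite prevs_leaf_loop //; case/andP: lv => _ /eqP.
exact/eqP/(prev_cycle (allP (system_cycle sysK) _ Kin)).
Qed.

(* The centre circuit has index 0, and a colour that occurs in no circuit has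
   index n.+1. *)
Definition circuit_index (c : C) : nat := find (has (fun v => vcol I v == c)) (K0 :: Ks).

Lemma circuit_index_lt c : (circuit_index c < n.+2)%N.
Proof. by rewrite ltnS; apply: find_size. Qed.

Lemma circuit_index_vcol i v : (i < n.+1)%N -> v \in circ i -> circuit_index (vcol I v) = i.
Proof.
move=> lt_i vi; rewrite /circuit_index; set has_col := has _.
have col_i : has_col (circ i) by apply/hasP; exists v.
have find_le : (find has_col (K0 :: Ks) <= i)%N.
  by rewrite leqNgt; apply/negP => /(before_find [::]); rewrite col_i.
apply/eqP; rewrite eqn_leq find_le leqNgt /=; apply/negP => find_lt.
have /(nth_find [::])/hasP[w wf /eqP wv] : has has_col (K0 :: Ks).
  by rewrite has_find (leq_ltn_trans find_le).
have /pairwiseP - /(_ [::] _ i) := system_disjoint sysK.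
move=> /(_ _ (leq_ltn_trans find_le lt_i) lt_i find_lt) /allrelP /(_ w v wf vi).
by rewrite wv eqxx.
Qed.

Lemma nth_circuit_cycle i : (i < n.+1)%N -> path.cycle (follows (vcol I) (tcol I)) (circ i).
Proof. by move=> lt_i; apply: (allP (system_cycle sysK)); rewrite mem_nth. Qed.

Lemma circuit_index_tcol i v : (i < n.+1)%N -> v \in circ i -> circuit_index (tcol I v) = i.
Proof.
move=> lt_i vi; have /eqP -> := next_cycle (nth_circuit_cycle lt_i) vi.
by apply: circuit_index_vcol; rewrite ?mem_next.
Qed.

Lemma mem_nth_circuit v : ~~ leaf_loop I v -> exists2 i, (i < n.+1)%N & v \in circ i.
Proof.
rewrite -(mem_system sysK) => /flattenP[K Kin vK].
by exists (index K (K0 :: Ks)); rewrite ?index_mem // nth_index.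
Qed.

Lemma circuit_index_edge v : circuit_index (vcol I v) = circuit_index (tcol I v).
Proof.
have [/andP[_ /eqP ->] //|/mem_nth_circuit[i lt_i vi]] := boolP (leaf_loop I v).
by rewrite (circuit_index_vcol lt_i vi) (circuit_index_tcol lt_i vi).
Qed.

Lemma circuit_index_centre : circuit_index (vcol I u) = 0%N.
Proof. exact: (circuit_index_vcol (i := 0)) centre_in. Qed.

(* This covers the tokens of leaf loops, which lie in no circuit. *)
Lemma nth_circuit_token_weight v (i := circuit_index (vcol I v)) : (i < n.+1)%N ->
  exists2 w, w \in circ i & wt w = wt v.
Proof.
move=> lt_i; have := lt_i; rewrite /i circuit_index_edge -[n.+1]/(size (K0 :: Ks)).
rewrite -has_find => /(nth_find [::])/hasP[w].
rewrite -/(circuit_index _) -circuit_index_edge => wi /eqP wv.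
exists (prev (circ i) w); first by rewrite mem_prev.
by rewrite /token_weight; have /eqP -> := prev_cycle (nth_circuit_cycle lt_i) wi; rewrite wv.
Qed.

Definition circuit_label (c : C) : 'I_n.+2 := Ordinal (circuit_index_lt c).

Definition other_label : pred 'I_n.+2 := fun X => (0 < X < n.+1)%N.

Lemma circuit_label_centre : circuit_label (vcol I u) = ord0.
Proof. by apply/val_inj; rewrite /= circuit_index_centre. Qed.

Lemma other_labelPn X : ~~ other_label X -> X = ord0 \/ X = ord_max.
Proof.
case: X => X lt_X; rewrite /other_label /= => not_other.
have [X0|X0] := posnP X; first by left; apply/val_inj.
by right; apply/val_inj => /=; move: not_other; rewrite X0 /= -leqNgt; lia.
Qed.

Definition unmet (O : {set 'I_n.+2}) : nat := #|[set X | other_label X] :\: O|.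

Lemma unmetU1 X (O : {set 'I_n.+2}) : X \notin O -> other_label X -> unmet O = (unmet (X |: O)).+1.
Proof.
move=> XO otherX; rewrite /unmet (cardsD1 X) !inE XO otherX /= add1n; congr _.+1.
by apply: eq_card => Y; rewrite !inE negb_or andbA.
Qed.

Lemma unmetU1_not_other X (O : {set 'I_n.+2}) : ~~ other_label X -> unmet (X |: O) = unmet O.
Proof.
move=> notX; apply: eq_card => Y; rewrite !inE negb_or.
by have [->|//] := eqVneq Y X; rewrite (negPf notX) !andbF.
Qed.

Lemma unmet_centre : unmet [set ord0] = n.
Proof.
rewrite /unmet.
have -> : [set X | other_label X] :\: [set ord0] = [set: 'I_n.+2] :\: [set ord0; ord_max].
  apply/setP => X; rewrite !inE /other_label andbT negb_or -!val_eqE /=.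
  by case: X => X /= lt_X; lia.
by rewrite cardsD setTI cards2 cardsT card_ord -val_eqE /=; lia.
Qed.

Lemma unmet_eq0 (O : {set 'I_n.+2}) : (forall X, other_label X -> X \in O) -> unmet O = 0%N.
Proof.
move=> met; apply/eqP; rewrite /unmet cards_eq0 setD_eq0; apply/subsetP => X.
by rewrite inE => /met.
Qed.

Hypothesis starI : star_instance I.

Lemma other_label_misplaced X : other_label X ->
  exists v, [/\ v != u, vcol I v != tcol I v & circuit_label (vcol I v) = X].
Proof.
case/andP=> X0 lt_X.
have KX : circ X \in Ks by case: (nat_of_ord X) X0 lt_X => // i _ lt_i; apply: mem_nth.
have := allP (system_nonempty sysK) _ KX; case circX : (circ X) => [//|v K] _.
have vX : v \in circ X by rewrite circX mem_head.
have indexE := circuit_index_vcol lt_X vX.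
have vu : v != u by apply: contraTneq X0 => vu; rewrite -leqNgt -indexE vu circuit_index_centre.
exists v; split=> //; last exact/val_inj.
have : ~~ leaf_loop I v by apply: system_mem vX; rewrite inE KX orbT.
by rewrite /leaf_loop leafE // vu.
Qed.

Lemma not_other_label_placed v : v != u -> ~~ other_label (circuit_label (vcol I v)) ->
  circuit_label (vcol I v) != circuit_label (vcol I u) -> vcol I v = tcol I v.
Proof.
move=> vu; rewrite circuit_label_centre /other_label -val_eqE /= -lt0n => not_other index_gt0.
have [/andP[_ /eqP //]|/mem_nth_circuit[i lt_i vi]] := boolP (leaf_loop I v).
by move: not_other; rewrite index_gt0 (circuit_index_vcol lt_i vi) lt_i.
Qed.

Lemma misplaced_weight1 :
  misplaced_weight I 1%g = \sum_(v <- behead K0 ++ flatten Ks) wt v.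
Proof.
have := system_uniq sysK; rewrite /= {1}(system_centre sysK) => /andP[uK uqK].
rewrite big_uniq //= /misplaced_weight big_mkcond [RHS]big_mkcond.
apply: eq_bigr => v _; rewrite /misplaced_at perm1.
have := mem_system sysK v; rewrite /= {1}(system_centre sysK) inE /leaf_loop leafE //.
have [->|vu] /= := eqVneq v u; first by rewrite (negPf uK).
by move=> ->; rewrite (eq_sym (tcol I v)); case: eqP.
Qed.

End CircuitSystem.

Section RemainingExtra.

Variables (R : realFieldType) (component_min token_min : R).

(* A lower bound for the weight of the additional arrivals at the centre when k
   circuits are still to be met: the first swap with a leaf loop costs two of
   them, of the foreign token left there and of the token of the loop. *)
Definition remaining_extra (k : nat) (loop_met : bool) : R :=
  if loop_met then k%:R * token_min
  else Num.min (k%:R * component_min) (k.+2%:R * token_min).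

Lemma remaining_extra_circuit k (loop_met : bool) w :
  token_min <= w -> (~~ loop_met -> component_min <= w) ->
  remaining_extra k.+1 loop_met <= remaining_extra k loop_met + w.
Proof.
case: loop_met => token_w /= component_w; first by rewrite -natr1; lra.
have := component_w isT; rewrite /remaining_extra -!natr1.
by case: (leP (k%:R * _)) => ?; case: (leP ((k%:R + 1) * _)) => ?; lra.
Qed.

Lemma remaining_extra_loop k w w' : token_min <= w -> token_min <= w' ->
  remaining_extra k false <= remaining_extra k true + w + w'.
Proof. by rewrite /remaining_extra /= -!natr1; case: (leP (_ * component_min)) => ?; lra. Qed.

Lemma remaining_extra0_le0 loop_met : remaining_extra 0 loop_met <= 0.
Proof. by case: loop_met; rewrite /remaining_extra ?ge_min mul0r ?lexx. Qed.

End RemainingExtra.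

Section ArrivalsBound.

Variables (R : realFieldType) (V C : finType) (I : instance R V C).
Hypothesis starI : star_instance I.

Variables (K0 : seq V) (Ks : seq (seq V)).
Hypothesis sysK : circuit_system I K0 Ks.

Local Notation u := (centre I).
Local Notation wt := (token_weight I).
Local Notation n := (size Ks).
Local Notation L := 'I_n.+2.
Local Notation label v := (circuit_label I K0 Ks (vcol I v)).
Local Notation index v := (circuit_index I K0 Ks (vcol I v)).

Variables (extra centre_min other_min token_min : R).
Hypothesis centre_minP : {in K0, forall v, centre_min <= wt v}.
Hypothesis other_minP : {in flatten Ks, forall v, other_min <= wt v}.
Hypothesis loop_minP : forall v, leaf_loop I v -> token_min <= wt v.
Hypothesis token_min_centre : token_min <= centre_min.
Hypothesis token_min_other : token_min <= other_min.
Hypothesis extra_stay : extra <= n%:R * centre_min.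
Hypothesis extra_other : (0 < n)%N -> extra <= centre_min + n.-1%:R * other_min.
Hypothesis extra_loop : extra <= centre_min + n.+1%:R * token_min.

Local Notation component_min := (Num.min centre_min other_min).
Local Notation remaining := (remaining_extra component_min token_min).

Definition extra_bound (O : {set L}) : R :=
  if O == [set ord0] then extra else remaining (unmet O) (ord_max \in O).

Lemma component_min_le v : (index v < n.+1)%N -> component_min <= wt v.
Proof.
move=> lt_index; have [w wi <-] := nth_circuit_token_weight sysK lt_index.
case: (circuit_index _ _ _ _) lt_index wi => [|i] /= lt_i wi; first by rewrite ge_min centre_minP.
rewrite ge_min other_minP ?orbT //; apply/flattenP; exists (nth [::] Ks i) => //.
exact: mem_nth.
Qed.

Lemma token_min_component : token_min <= component_min.
Proof. by rewrite le_min token_min_centre. Qed.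

Lemma token_minP v : token_min <= wt v.
Proof.
have [/loop_minP //|/(mem_nth_circuit sysK)[i lt_i vi]] := boolP (leaf_loop I v).
apply: (le_trans token_min_component); apply: component_min_le.
by rewrite (circuit_index_vcol sysK lt_i vi).
Qed.

Lemma extra_component : (0 < n)%N -> extra <= centre_min + n.-1%:R * component_min.
Proof.
move=> n_gt0; case: (leP centre_min other_min) => _; last exact: extra_other.
by move: extra_stay; case: (n) n_gt0 => // k _ /=; rewrite -natr1; lra.
Qed.

Lemma extra_start_circuit k w : n = k.+1 -> centre_min <= w ->
  extra <= remaining k false + w.
Proof.
move=> nE centre_w; have := extra_loop; have := extra_component.
rewrite nE /remaining_extra /= => /(_ isT).
by case: (leP (k%:R * _)) => ? ?; lra.
Qed.

Lemma extra_start_loop w w' : centre_min <= w -> token_min <= w' ->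
  extra <= remaining n true + w + w'.
Proof. by have := extra_loop; rewrite /remaining_extra -natr1; lra. Qed.

Lemma extra_bound_step (O : {set L}) (x l : V) :
  label u \in O -> label x \in O -> label l \notin O ->
  extra_bound O <= extra_bound (label l |: O) + wt x
                   + (if other_label (label l) then 0 else wt l).
Proof.
rewrite (circuit_label_centre sysK); set X := label l => ord0_O xO XO.
have met_X : (X |: O == [set ord0]) = false.
  apply/negbTE; apply: contraNneq XO => XO0.
  by have := setU11 X O; rewrite XO0 inE => /eqP->.
have component_x : ord_max \notin O -> component_min <= wt x.
  move=> max_O; apply: component_min_le; rewrite ltn_neqAle -ltnS circuit_index_lt andbT.
  apply: contra max_O => /eqP max_x.
  by rewrite (_ : ord_max = label x) //; apply/val_inj.
have centre_x : O = [set ord0] -> centre_min <= wt x.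
  move=> O0; move: xO; rewrite O0 inE => /eqP/(congr1 val) /= index_x.
  by have [] := nth_circuit_token_weight sysK (v := x); rewrite index_x // => y /centre_minP ? <-.
rewrite {2}/extra_bound met_X /extra_bound.
have [otherX|not_other] := boolP (other_label X).
  have -> : (ord_max \in X |: O) = (ord_max \in O).
    rewrite in_setU1; case: eqP => // max_X; move: otherX.
    by rewrite -max_X /other_label /= ltnn.
  rewrite addr0 (unmetU1 XO otherX); have [O0|_] := eqVneq O [set ord0].
    rewrite {2}O0 inE /=; apply: extra_start_circuit (centre_x O0).
    by rewrite -(unmetU1 XO otherX) {1}O0 unmet_centre.
  exact: remaining_extra_circuit (token_minP x) component_x.
have [X0|Xmax] := other_labelPn not_other; first by rewrite X0 ord0_O in XO.
rewrite unmetU1_not_other // Xmax setU11; have [O0|_] := eqVneq O [set ord0].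
  by rewrite O0 unmet_centre; apply: extra_start_loop (centre_x O0) (token_minP l).
rewrite -Xmax (negPf XO).
exact: remaining_extra_loop (token_minP x) (token_minP l).
Qed.

Lemma extra_bound_end (O : {set L}) :
  (forall X, other_label X -> X \in O) -> extra_bound O <= 0.
Proof.
move=> met; rewrite /extra_bound (unmet_eq0 met); case: eqP => [O0|_].
  have size0 : n = 0%N by rewrite -(unmet_eq0 met) O0 unmet_centre.
  by move: extra_stay; rewrite size0 mul0r.
exact: remaining_extra0_le0.
Qed.

Lemma coloured_arrivals_ge ls : u \notin ls ->
  (forall v, tcol I (centre_run u ls v) = vcol I v) ->
  \sum_(v <- behead K0 ++ flatten Ks) wt v + extra <= arrivals wt u 1%g ls.
Proof.
move=> uls sol; rewrite -(misplaced_weight1 sysK starI).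
have <- : extra_bound [set ord0] = extra by rewrite /extra_bound eqxx.
apply: (arrivals_ge_potential starI (label := circuit_label I K0 Ks)
          (nontrivial := @other_label _ Ks)) => //.
- by move=> v; apply/val_inj/circuit_index_edge.
- exact: other_label_misplaced.
- exact: not_other_label_placed.
- exact: extra_bound_step.
- exact: extra_bound_end.
- by rewrite (circuit_label_centre sysK) inE.
- by move=> v _; rewrite perm1.
- by move=> v; rewrite perm1.
Qed.

End ArrivalsBound.

(** * The cheapest detour *)

Definition add_for_each (T : Type) (R : zmodType) (m a : R) (s : seq T) : R :=
  foldr (fun _ r => m + r) a s.

Lemma add_for_eachE (T : Type) (R : pzRingType) (m a : R) (s : seq T) :
  add_for_each m a s = (size s)%:R * m + a.
Proof.
by elim: s => [|x s IH] /=; rewrite ?mul0r ?add0r // IH -natr1 mulrDl mul1r addrA (addrC m).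
Qed.

(* Swaps that solve all circuits but that of the centre, where [detour_extra] is
   the total weight of the arrivals at the centre that are not the first ones of
   tokens of these circuits. *)
Record detour (R V : Type) := Detour { detour_extra : R; detour_leaves : seq V }.

Section Detours.

Variables (R : realFieldType) (V C : finType) (I : instance R V C).

Local Notation u := (centre I).
Local Notation wt := (token_weight I).

Definition pivot_circuit (K : seq V) : pivoted V :=
  if K is x :: s then pivot_min wt x s else Pivoted [::] u [::].

Definition pivot_weight (K : pivoted V) : R := wt (pivot K).

Lemma glue_pivot_circuit K : K != [::] -> glue (pivot_circuit K) = K.
Proof. by case: K => // x s _; apply: glue_pivot_min. Qed.

Lemma pivot_circuit_le K : {in K, forall v, pivot_weight (pivot_circuit K) <= wt v}.
Proof. by case: K => // x s; apply/allP/(pivot_min_le wt). Qed.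

Implicit Types (m : R) (Ks : seq (pivoted V)) (ls : seq V) (d : detour R V).

(* Every circuit costs one more arrival of the token that waits at the centre
   for it to be solved: the lightest token of weight m of the circuit of the
   centre, or the lightest one of another circuit, or that of a leaf loop.  The
   difference m - m is how a program obtains 0. *)
Definition detour_stay m Ks : detour R V :=
  Detour (add_for_each m (m - m) Ks) (excursions Ks).

Definition detour_other m Ks : option (detour R V) :=
  if Ks is K :: Ks' then
    let S := pivot_min pivot_weight K Ks' in
    Some (Detour (add_for_each (pivot_weight (pivot S)) m (before S ++ after S))
                 (excursion (pivot S) (excursions (before S ++ after S))))
  else None.

Definition detour_loop m Ks ls : option (detour R V) :=
  if ls is l :: ls' then
    let x := pivot (pivot_min wt l ls') in
    Some (Detour (add_for_each (wt x) (m + wt x) Ks)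
                 (excursion (Pivoted [::] x [::]) (excursions Ks)))
  else None.

Definition cheaper d (o : option (detour R V)) : detour R V :=
  if o is Some d' then if detour_extra d' <= detour_extra d then d' else d else d.

Definition best_detour m Ks ls : detour R V :=
  cheaper (cheaper (detour_stay m Ks) (detour_other m Ks)) (detour_loop m Ks ls).

(* The first leaf of the circuit of the centre is the centre itself. *)
Definition plan (K : pivoted V) Ks ls : seq V :=
  behead (insert_at K (detour_leaves (best_detour (pivot_weight K) Ks ls))).

Lemma cheaper_le d o : detour_extra (cheaper d o) <= detour_extra d.
Proof. by case: o => //= d'; case: ifP. Qed.

Lemma cheaper_le_some d d' : detour_extra (cheaper d (Some d')) <= detour_extra d'.
Proof. by rewrite /=; case: ifPn => //; rewrite -ltNge => /ltW. Qed.

Hypothesis starI : star_instance I.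

Lemma pivot_weight_ge0 K : 0 <= pivot_weight K.
Proof. exact/ltW/token_weight_gt0. Qed.

Variables (K0 : seq V) (Ks : seq (seq V)) (loops : seq V).
Hypothesis sysK : circuit_system I K0 Ks.
Hypothesis mem_loops : forall l, (l \in loops) = leaf_loop I l.

Local Notation n := (size Ks).
Local Notation P0 := (pivot_circuit K0).
Local Notation Ps := (map pivot_circuit Ks).
Local Notation centre_min := (pivot_weight P0).
Local Notation best := (best_detour centre_min Ps loops).

Lemma glue_centre_circuit : glue P0 = K0.
Proof. by apply: glue_pivot_circuit; rewrite (system_centre sysK). Qed.

Lemma map_glue_circuits : map (@glue V) Ps = Ks.
Proof.
rewrite -map_comp -[RHS]map_id; apply/eq_in_map => K KK /=.
by apply: glue_pivot_circuit; apply: (allP (system_nonempty sysK)).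
Qed.

Lemma glues_circuits : glues Ps = flatten Ks.
Proof. by rewrite /glues map_glue_circuits. Qed.

Definition valid_detour d : Prop :=
  [/\ u \notin detour_leaves d, centre_run u (detour_leaves d) =1 prevs Ks
    & forall s : {perm V}, (forall v, v \notin K0 -> s v = v) -> wt (s u) = centre_min ->
      arrivals wt u s (detour_leaves d) = \sum_(v <- flatten Ks) wt v + detour_extra d].

Lemma sum_others_fixed (s : {perm V}) : (forall v, v \notin K0 -> s v = v) ->
  \sum_(v <- flatten Ks) wt (s v) = \sum_(v <- flatten Ks) wt v.
Proof.
by move=> fixs; apply: eq_big_seq => v /(others_notin_centre_circuit sysK)/fixs ->.
Qed.

Lemma valid_detour_stay : valid_detour (detour_stay centre_min Ps).
Proof.
have uq := others_uniq sysK; split=> /=.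
- by rewrite mem_excursions glues_circuits; case/andP: uq.
- by move=> v; rewrite centre_run_excursions ?map_glue_circuits // glues_circuits.
move=> s fixs su; rewrite arrivals_excursions glues_circuits // su size_map.
by rewrite add_for_eachE subrr addr0 mulr_natl size_map sum_others_fixed.
Qed.

Lemma valid_detour_other d : detour_other centre_min Ps = Some d -> valid_detour d.
Proof.
rewrite /detour_other; case PsE : Ps => [//|P Ps'] [<-].
set S := pivot_min _ _ _; set rest := before S ++ after S.
have permK : perm_eq (map (@glue V) (pivot S :: rest)) Ks.
  rewrite -map_glue_circuits PsE -(glue_pivot_min pivot_weight P Ps') -/S.
  rewrite -[glue S]/(before S ++ pivot S :: after S) map_cons !map_cat.
  by apply/permEl/(perm_catCA [:: _]).
have perm_flat : perm_eq (glue (pivot S) ++ glues rest) (flatten Ks) := perm_flatten permK.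
have uq : uniq (u :: glue (pivot S) ++ glues rest).
  rewrite (perm_uniq (_ : perm_eq _ (u :: flatten Ks))) ?perm_cons //.
  exact: others_uniq sysK.
split=> /=.
- rewrite mem_excursion mem_cat mem_excursions -mem_cat.
  by case/andP: uq.
- move=> v; rewrite centre_run_nested //; apply: perm_prevs => //.
  by case/andP: uq.
move=> s fixs su; rewrite arrivals_nested // su (perm_big _ perm_flat) /= sum_others_fixed //.
rewrite fixs; last first.
  by apply: (others_notin_centre_circuit sysK); rewrite -(perm_mem perm_flat) mem_cat mem_pivot.
by rewrite add_for_eachE -[_ *+ _]mulr_natl -addrA [centre_min + _]addrC.
Qed.

Lemma valid_detour_loop d : detour_loop centre_min Ps loops = Some d -> valid_detour d.
Proof.
rewrite /detour_loop; case loopsE : loops => [//|l ls] [<-].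
set x := pivot _; have xin : x \in loops by rewrite loopsE -(glue_pivot_min wt) mem_pivot.
have [xK0 xKs] : x \notin K0 /\ x \notin flatten Ks.
  by apply/andP; rewrite -negb_or -mem_cat (mem_system sysK) negbK -mem_loops.
have ux : u != x by apply: contraNneq xK0 => <-; apply: centre_in sysK.
have uq : uniq (u :: glue (Pivoted [::] x [::]) ++ glues Ps).
  have := others_uniq sysK; rewrite glues_circuits /= inE negb_or xKs ux.
  by case/andP=> -> ->.
split.
- rewrite mem_excursion mem_cat mem_excursions -mem_cat.
  by case/andP: uq.
- move=> v; rewrite centre_run_nested // map_cons map_glue_circuits /=.
  by case: eqP.
move=> s fixs su; rewrite arrivals_nested // su glues_circuits big_cons sum_others_fixed //.
by rewrite fixs // add_for_eachE size_map -[_ *+ _]mulr_natl /=; ring.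
Qed.

Lemma valid_cheaper d o : valid_detour d ->
  (forall d', o = Some d' -> valid_detour d') -> valid_detour (cheaper d o).
Proof. by move=> valid_d; case: o => //= d' valid_d'; case: ifP => // _; apply: valid_d'. Qed.

Lemma valid_best_detour : valid_detour best.
Proof.
apply: valid_cheaper valid_detour_loop.
exact: valid_cheaper valid_detour_stay valid_detour_other.
Qed.

Lemma best_le_stay : detour_extra best <= n%:R * centre_min.
Proof.
apply: le_trans (cheaper_le _ _) _; apply: le_trans (cheaper_le _ _) _.
by rewrite /= add_for_eachE size_map subrr addr0.
Qed.

Lemma best_le_other : exists other_min,
  [/\ 0 <= other_min, {in flatten Ks, forall v, other_min <= wt v}
    & (0 < n)%N -> detour_extra best <= centre_min + n.-1%:R * other_min].
Proof.
have [n0|n_gt0] := posnP n; first by exists 0; rewrite (size0nil n0).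
have : size Ps = n by rewrite size_map.
rewrite /best_detour /detour_other; case PsE : Ps => [|P Ps'] sizeE.
  by rewrite -sizeE in n_gt0.
set S := pivot_min _ _ _; exists (pivot_weight (pivot S)).
split=> [|v /flattenP[K Kin vK]|_]; first exact: pivot_weight_ge0.
  apply: le_trans (pivot_circuit_le vK).
  have := pivot_min_le pivot_weight P Ps'.
  by rewrite -PsE all_map => /allP/(_ K Kin).
apply: le_trans (cheaper_le _ _) _; apply: le_trans (cheaper_le_some _ _) _.
rewrite /= add_for_eachE addrC -sizeE size_cat.
by rewrite -(glue_pivot_min pivot_weight P Ps') size_cat /= addnS.
Qed.

Lemma best_le_loop token_min : detour_extra best <= centre_min + n.+1%:R * token_min ->
  exists token_min', [/\ token_min' <= token_min,
    forall l, leaf_loop I l -> token_min' <= wt l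
    & detour_extra best <= centre_min + n.+1%:R * token_min'].
Proof.
case loopsE : loops => [|l ls] best_le.
  exists token_min; split=> // l; by rewrite -mem_loops loopsE.
set loop_min := wt (pivot (pivot_min wt l ls)).
have loop_minP l' : leaf_loop I l' -> loop_min <= wt l'.
  by rewrite -mem_loops loopsE => /(allP (pivot_min_le wt l ls)).
have best_le_loop : detour_extra best <= centre_min + n.+1%:R * loop_min.
  rewrite loopsE; apply: le_trans (cheaper_le_some _ _) _.
  by rewrite /= add_for_eachE size_map -natr1 -/loop_min; lra.
exists (Num.min loop_min token_min); split; first by rewrite ge_min lexx orbT.
  by move=> l' /loop_minP; rewrite ge_min => ->.
by move: best_le; rewrite -loopsE; case: (leP loop_min).
Qed.

Lemma best_le_arrivals ls : u \notin ls ->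
  (forall v, tcol I (centre_run u ls v) = vcol I v) ->
  \sum_(v <- behead K0 ++ flatten Ks) wt v + detour_extra best <= arrivals wt u 1%g ls.
Proof.
move=> uls sol; have [other_min [other_min_ge0 other_minP best_other]] := best_le_other.
have best_min : detour_extra best <= centre_min + n.+1%:R * Num.min centre_min other_min.
  have := best_le_stay; have := pivot_weight_ge0 P0.
  case: (leP centre_min) => _; first by rewrite -natr1; lra.
  by case: (n) best_other => [|k /(_ isT)] /=; rewrite -!natr1; lra.
have [token_min [le_min loop_minP best_loop]] := best_le_loop best_min.
move: le_min; rewrite le_min => /andP[le_centre le_other].
apply: (coloured_arrivals_ge starI sysK (@pivot_circuit_le K0) other_minP loop_minP) => //.
exact: best_le_stay.
Qed.

Definition plan_leaves : seq V := plan P0 Ps loops.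

Lemma plan_decomposition : exists a b,
  [/\ plan_leaves = a ++ detour_leaves best ++ b, K0 = u :: a ++ b & last u a = pivot P0].
Proof.
exists (behead (rcons (before P0) (pivot P0))), (after P0).
have glueE : rcons (before P0) (pivot P0) ++ after P0 = u :: behead K0.
  by rewrite glue_rcons glue_centre_circuit -(system_centre sysK).
rewrite /plan_leaves /plan insert_at_rcons.
move: glueE (last_rcons u (before P0) (pivot P0)) (size_rcons (before P0) (pivot P0)).
case: (rcons _ _) => //= x a [-> beheadE] <- _; split=> //.
by rewrite beheadE -(system_centre sysK).
Qed.

Lemma plan_leavesP : [/\ u \notin plan_leaves,
  centre_run u plan_leaves =1 prevs (K0 :: Ks)
  & arrivals wt u 1%g plan_leaves =
    \sum_(v <- behead K0 ++ flatten Ks) wt v + detour_extra best].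
Proof.
have [a [b [-> K0E last_a]]] := plan_decomposition.
have [uM runM arrivalsM] := valid_best_detour.
have uq : uniq (u :: a ++ b).
  by rewrite -K0E; apply: (circuit_uniq sysK); apply: mem_head.
have [uqa _] := uniq_cons_cat uq.
have fixM : {in K0, centre_run u (detour_leaves best) =1 id}.
  by move=> v vK; rewrite runM prevs_notin // (uniq_cat_notinl (system_uniq sysK)).
have fixMb : {in u :: b, centre_run u (detour_leaves best) =1 id}.
  move=> v vb; apply: fixM; move: vb; rewrite K0E !inE mem_cat.
  by case/orP=> ->; rewrite ?orbT.
split.
- by move: uq; rewrite /= !mem_cat !negb_or uM => /andP[/andP[-> ->]].
- by move=> v; rewrite centre_run_insert // permM runM centre_run_trail // K0E.
rewrite arrivals_insert //; last by move=> v vb; apply: fixMb; rewrite inE vb orbT.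
rewrite mulg1 arrivalsM.
- rewrite [behead K0](congr1 behead K0E) [in RHS]big_cat /= addrA; congr (_ + _ + _).
  by apply: eq_bigr => v _; rewrite perm1.
- move=> v vK; apply: centre_run_notin; apply: contra vK.
  by rewrite K0E !inE mem_cat => /orP[->//|->]; rewrite orbT.
- by rewrite centre_run_centre // last_a.
Qed.

Lemma plan_solves : solves_coloured I (centre_swaps u plan_leaves).
Proof.
have [u_notin runE _] := plan_leavesP.
split=> [|v]; first by rewrite swap_sequence_centre_swaps.
by rewrite -/(centre_run u plan_leaves) runE tcol_prevs.
Qed.

Lemma plan_optimal : optimal I (solves_coloured I) (centre_swaps u plan_leaves).
Proof.
split=> [|sigma [sw sol]]; first exact: plan_solves.
have [_ runE arrivalsE] := plan_leavesP.
have [ls [uls run_ls costE]] := swap_sequence_of_centre_swaps starI sw.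
have sol_ls v : tcol I (centre_run u ls v) = vcol I v by rewrite -run_ls.
have last_centre : wt (centre_run u ls u) = wt (centre_run u plan_leaves u).
  by rewrite /token_weight sol_ls runE tcol_prevs.
have := best_le_arrivals uls sol_ls.
by rewrite /cost costE !cost_from_centre_swaps // arrivalsE !perm1 last_centre; lra.
Qed.

End Detours.

(** * Minimum costs *)

Section Minimum.

Variables (R : realFieldType) (V C : finType) (I : instance R V C).
Hypothesis starI : star_instance I.

Lemma swap_sequence_cat sigma sigma' :
  swap_sequence I (sigma ++ sigma') = swap_sequence I sigma && swap_sequence I sigma'.
Proof. exact: all_cat. Qed.

Lemma cost_from_cat s sigma sigma' :
  cost_from I s (sigma ++ sigma') = cost_from I s sigma + cost_from I (run s sigma) sigma'.
Proof. by elim: sigma s => [|e sigma IH] s /=; rewrite ?add0r // IH addrA. Qed.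

Lemma cost_from_ge0 s sigma : 0 <= cost_from I s sigma.
Proof.
by elim: sigma s => //= e sigma IH s; rewrite !addr_ge0 ?IH // ltW // token_weight_gt0.
Qed.

Lemma cut_repeated_placement sigma : (#|{: {perm V}}| < size sigma)%N ->
  exists sigma', [/\ (size sigma' < size sigma)%N, run 1%g sigma' = run 1%g sigma,
    cost I sigma' <= cost I sigma & swap_sequence I sigma -> swap_sequence I sigma'].
Proof.
move=> lt_size; pose placements := [seq run 1%g (take i sigma) | i <- iota 0 (size sigma)].
have /(uniqPn 1%g)[i [j [lt_ij]]] : ~~ uniq placements.
  apply: contraL lt_size => /card_uniqP card_placements; rewrite -leqNgt.
  have <- : size placements = size sigma by rewrite size_map size_iota.
  by rewrite -card_placements; apply: max_card.
rewrite size_map size_iota => lt_j; have lt_i := ltn_trans lt_ij lt_j.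
rewrite !(nth_map 0%N) ?size_iota // !nth_iota // !add0n => repeated.
have sigmaE : sigma = take i sigma ++ (drop i (take j sigma) ++ drop j sigma).
  by rewrite catA -{1}(take_takel sigma (ltnW lt_ij)) !cat_take_drop.
have run_cut : run (run 1%g (take i sigma)) (drop i (take j sigma)) = run 1%g (take i sigma).
  by rewrite -run_cat -{1}(take_takel sigma (ltnW lt_ij)) cat_take_drop.
exists (take i sigma ++ drop j sigma); split.
- by rewrite size_cat size_take size_drop lt_i; lia.
- by rewrite [in RHS]sigmaE !run_cat run_cut.
- rewrite /cost [in leRHS]sigmaE !cost_from_cat run_cut lerD2l.
  by rewrite lerDr cost_from_ge0.
- by rewrite [in swap_sequence I sigma]sigmaE !swap_sequence_cat => /and3P[-> _ ->].
Qed.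

Lemma shorten_swaps sigma : exists sigma', [/\ (size sigma' <= #|{: {perm V}}|)%N,
  run 1%g sigma' = run 1%g sigma, cost I sigma' <= cost I sigma
  & swap_sequence I sigma -> swap_sequence I sigma'].
Proof.
have [n] := ubnP (size sigma); elim: n sigma => // n IH sigma; rewrite ltnS => size_le.
have [short|/cut_repeated_placement] := leqP (size sigma) #|{: {perm V}}|; first by exists sigma.
case=> tau [size_tau run_tau cost_tau sw_tau].
have [rho [size_rho run_rho cost_rho sw_rho]] := IH tau (leq_trans size_tau size_le).
exists rho; split=> //; first by rewrite run_rho.
  exact: le_trans cost_rho cost_tau.
by move=> /sw_tau/sw_rho.
Qed.

(* The bound on the length makes the search finite: R need not be archimedean. *)
Lemma min_cost_exists (solves : seq (V * V) -> Prop) (goal : pred {perm V}) sigma :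
  (forall tau, solves tau <-> swap_sequence I tau && goal (run 1%g tau)) ->
  solves sigma -> exists x, min_cost I solves x.
Proof.
move=> solvesP; pose N := #|{: {perm V}}|.
pose short_solution (a : N.-bseq (V * V)) := swap_sequence I a && goal (run 1%g a).
have short tau : solves tau -> exists2 a, short_solution a & cost I a <= cost I tau.
  move=> /solvesP/andP[sw sol]; have [rho [size_rho run_rho cost_rho sw_rho]] := shorten_swaps tau.
  by exists (Bseq size_rho) => //; rewrite /short_solution /= sw_rho //= run_rho.
move=> /short[a0 sol0 _].
case: (arg_minP (fun a : N.-bseq (V * V) => cost I a) sol0) => a sol_a min_a.
exists (cost I a); split; first by exists a => //; apply/solvesP.
by move=> x [tau /short[b sol_b le_b] <-]; apply: le_trans le_b; apply: min_a.
Qed.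

Lemma Fcost_exists T : bijective T -> exists x, Fcost I T x.
Proof.
case=> T' TK T'K; have injT' : injective T' by apply: can_inj T'K.
have [ls uls runE] := centre_run_surj (centre I) (perm injT').
apply: (min_cost_exists (goal := fun p => [forall v, T (p v) == v])
                        (sigma := centre_swaps (centre I) ls)).
  move=> tau; split=> [[sw sol]|/andP[sw /forallP sol]].
    by apply/andP; split=> //; apply/forallP => v; rewrite sol.
  by split=> // v; apply/eqP.
split=> [|v]; first by rewrite swap_sequence_centre_swaps.
by rewrite -/(centre_run _ _) runE permE T'K.
Qed.

Lemma solves_uncoloured_coloured T sigma : token_vertex_assignment I T ->
  solves_uncoloured I T sigma -> solves_coloured I sigma.
Proof. by move=> [_ vcolT] [sw sol]; split=> // v; rewrite -vcolT sol. Qed.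

Section OptimalAssignment.

Variables (T : V -> V) (sigma : seq (V * V)).
Hypothesis assignT : token_vertex_assignment I T.
Hypothesis solT : solves_uncoloured I T sigma.
Hypothesis opt : optimal I (solves_coloured I) sigma.

Lemma optimal_uncoloured_coloured tau :
  optimal I (solves_uncoloured I T) tau -> optimal I (solves_coloured I) tau.
Proof.
move=> [sol_tau min_tau]; split; first exact: solves_uncoloured_coloured sol_tau.
by move=> rho /(proj2 opt); apply: le_trans; apply: min_tau.
Qed.

Lemma Fcost_optimal : Fcost I T (cost I sigma).
Proof.
split=> [|x [tau /(solves_uncoloured_coloured assignT)/(proj2 opt) le_tau <-] //].
by exists sigma.
Qed.

Lemma min_Fcost_optimal : is_minimum
  (fun x => exists2 T, token_vertex_assignment I T & Fcost I T x) (cost I sigma).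
Proof.
split=> [|x [T' assignT' [[tau sol_tau <-] _]]]; first by exists T => //; apply: Fcost_optimal.
exact/(proj2 opt)/(solves_uncoloured_coloured assignT').
Qed.

Lemma min_cost_optimal : min_cost I (solves_coloured I) (cost I sigma).
Proof.
by case: opt => sol min_sigma; split=> [|x [tau /min_sigma le_tau <-] //]; exists sigma.
Qed.

End OptimalAssignment.

End Minimum.

(** * Assignments and systems of circuits *)

Section Assignment.

Variables (R : realFieldType) (V C : finType) (I : instance R V C).
Hypothesis starI : star_instance I.

Local Notation u := (centre I).

Definition leaf_loops : seq V := [seq v <- enum V | leaf_loop I v].

Lemma mem_leaf_loops v : (v \in leaf_loops) = leaf_loop I v.
Proof. by rewrite mem_filter mem_enum andbT. Qed.

Lemma centre_not_leaf_loop : ~~ leaf_loop I u.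
Proof. by rewrite /leaf_loop leafE // eqxx. Qed.

Lemma G'_adj_sym : symmetric (G'_adj I).
Proof. by move=> c d; apply: eq_existsb => v; rewrite orbC. Qed.

Lemma G'_adj_edge v : ~~ leaf_loop I v -> G'_adj I (vcol I v) (tcol I v).
Proof. by move=> not_loop; apply/exists_inP; exists v; rewrite ?inE ?not_loop // !eqxx. Qed.

Lemma connect_cycle_vcol (K : seq V) v w :
  path.cycle (follows (vcol I) (tcol I)) K ->
  (forall x, x \in K -> ~~ leaf_loop I x) -> v \in K -> w \in K ->
  connect (G'_adj I) (vcol I v) (vcol I w).
Proof.
move=> cycK edges vK wK.
have cycK' : path.cycle [rel x y | ~~ leaf_loop I x && (tcol I x == vcol I y)] K.
  apply: (sub_in_cycle (P := mem K)) cycK; last exact/allP.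
  by move=> x y xK _; rewrite /follows /= => ->; rewrite edges.
have /connectP[p path_p ->] := connect_cycle cycK' vK wK.
elim: p v path_p {vK} => [|y p IH] v /=; first by rewrite connect0.
case/andP=> /andP[not_loop /eqP vy] /IH; apply: connect_trans.
by rewrite -vy; apply/connect1/G'_adj_edge.
Qed.

Section OfSystem.

Variables (K0 : seq V) (Ks : seq (seq V)).
Hypothesis sysK : circuit_system I K0 Ks.

Lemma circuit_index_connect c d : connect (G'_adj I) c d ->
  circuit_index I K0 Ks c = circuit_index I K0 Ks d.
Proof.
case/connectP=> p path_p ->; elim: p c path_p => //= d' p IH c /andP[cd /IH <-].
by case/exists_inP: cd => v _ /orP[] /andP[/eqP <- /eqP <-]; rewrite (circuit_index_edge sysK).
Qed.

Lemma system_eulerian_circuit K c v : K \in K0 :: Ks -> v \in K ->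
  connect (G'_adj I) c (vcol I v) -> eulerian_circuit I (G'_component I c) K.
Proof.
move=> Kin vK cv; have cycK := allP (system_cycle sysK) _ Kin.
split=> //; first exact: (circuit_uniq sysK).
move=> w; rewrite !inE; apply/idP/andP => [wK|[not_loop cw]].
  split; first exact: (system_mem sysK Kin).
  apply: connect_trans cv _; apply: (connect_cycle_vcol cycK) => // x.
  exact: (system_mem sysK Kin).
have [i lt_i wi] := mem_nth_circuit sysK not_loop.
have KE : nth [::] (K0 :: Ks) (index K (K0 :: Ks)) = K by rewrite nth_index.
have lt_K : (index K (K0 :: Ks) < (size Ks).+1)%N by rewrite (@index_mem _ _ (K0 :: Ks)).
rewrite -{1}KE in vK; suff -> : K = nth [::] (K0 :: Ks) i by [].
rewrite -KE -(circuit_index_vcol sysK lt_i wi) -(circuit_index_vcol sysK lt_K vK).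
by rewrite -(circuit_index_connect cw) -(circuit_index_connect cv).
Qed.

Lemma cancel_prevs T : (forall v, leaf_loop I v -> T v = v) ->
  (forall K v, K \in K0 :: Ks -> v \in K -> T v = next K v) -> cancel (prevs (K0 :: Ks)) T.
Proof.
move=> T_loop T_circuit v; have [lv|/(system_prevs sysK)[K [Kin vK ->]]] := boolP (leaf_loop I v).
  by rewrite (prevs_leaf_loop sysK) // T_loop.
by rewrite (T_circuit K) ?mem_prev // next_prev // (circuit_uniq sysK).
Qed.

Lemma prevs_assignment T : cancel (prevs (K0 :: Ks)) T -> token_vertex_assignment I T.
Proof.
move=> prevsK; have TK := canF_sym prevsK.
by split=> [|t]; [exists (prevs (K0 :: Ks)) | rewrite -(tcol_prevs sysK) TK].
Qed.

Lemma plan_solves_uncoloured T : cancel (prevs (K0 :: Ks)) T ->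
  solves_uncoloured I T (centre_swaps u (plan_leaves I K0 Ks leaf_loops)).
Proof.
move=> prevsK; have [u_notin runE _] := plan_leavesP sysK mem_leaf_loops.
split=> [|v]; first by rewrite swap_sequence_centre_swaps.
by rewrite -/(centre_run _ _) runE prevsK.
Qed.

Lemma system_TA : exists T, is_TA I T.
Proof.
have [_ runE _] := plan_leavesP sysK mem_leaf_loops.
set p := centre_run u _ in runE; exists (p^-1)%g; split=> [v lv|c].
  by apply: (canLR (permK p)); rewrite runE (prevs_leaf_loop sysK).
have [/existsP[v /andP[not_loop cv]]|no_edge] :=
    boolP [exists v, ~~ leaf_loop I v && connect (G'_adj I) c (vcol I v)].
  have [K [Kin vK _]] := system_prevs sysK not_loop.
  exists K; first exact: system_eulerian_circuit Kin vK cv.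
  move=> w wK; apply: (canLR (permK p)); rewrite runE.
  rewrite (prevs_in (system_uniq sysK) Kin) ?mem_next //.
  by rewrite prev_next // (circuit_uniq sysK).
exists [::] => //; split=> // v; rewrite !inE.
by apply/esym/negbTE; apply: contra no_edge => edge_v; apply/existsP; exists v.
Qed.

End OfSystem.

Section ComponentCircuits.

Variable s : C -> seq V.
Hypothesis circuit_s : forall c, eulerian_circuit I (G'_component I c) (s c).

Local Notation component := (fingraph.root (G'_adj I)).

Definition centre_circuit : seq V := rot (index u (s (vcol I u))) (s (vcol I u)).

Definition other_components : seq C :=
  [seq c <- enum C | [&& component c == c, c != component (vcol I u) & s c != [::]]].

Let sym_connect_G' : connect_sym (G'_adj I) := sym_connect_sym G'_adj_sym.

Lemma mem_component_circuit c v :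
  (v \in s c) = ~~ leaf_loop I v && connect (G'_adj I) c (vcol I v).
Proof. by case: (circuit_s c) => _ -> _; rewrite !inE. Qed.

Lemma component_vcol c v : v \in s c -> component (vcol I v) = component c.
Proof. by rewrite mem_component_circuit => /andP[_ cv]; apply/esym/eqP; rewrite root_connect. Qed.

Lemma src_disjoint_components c d :
  component c != component d -> src_disjoint (vcol I) (s c) (s d).
Proof.
move=> cd; apply/allrelP => v w /component_vcol compv /component_vcol compw.
by apply: contraNneq cd => vw; rewrite -compv vw compw.
Qed.

Lemma mem_centre_circuit v : (v \in centre_circuit) = (v \in s (vcol I u)).
Proof. exact: mem_rot. Qed.

Lemma other_componentsP c : c \in other_components ->
  [/\ component c = c, c != component (vcol I u) & s c != [::]].
Proof. by rewrite mem_filter => /andP[/and3P[/eqP]]. Qed.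

Lemma centre_circuitE : centre_circuit = u :: behead centre_circuit.
Proof.
have us : u \in s (vcol I u).
  by rewrite mem_component_circuit centre_not_leaf_loop connect0.
by rewrite /centre_circuit /rot (drop_nth u) ?index_mem // nth_index.
Qed.

Lemma component_circuits_disjoint :
  pairwise (src_disjoint (vcol I)) (centre_circuit :: map s other_components).
Proof.
rewrite pairwise_cons pairwise_map; apply/andP; split.
  apply/allP => _ /mapP[c /other_componentsP[cE cu _] ->].
  have /allrelP disj : src_disjoint (vcol I) (s (vcol I u)) (s c).
    by apply: src_disjoint_components; rewrite cE eq_sym.
  by apply/allrelP => v w; rewrite mem_centre_circuit; apply: disj.
have : uniq other_components by rewrite filter_uniq // enum_uniq.
rewrite uniq_pairwise; apply: (sub_in_pairwise (P := mem other_components)); last exact/allP.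
move=> c d /other_componentsP[cE _ _] /other_componentsP[dE _ _] /= cd.
by apply: src_disjoint_components; rewrite cE dE.
Qed.

Lemma mem_component_circuits v :
  (v \in flatten (centre_circuit :: map s other_components)) = ~~ leaf_loop I v.
Proof.
apply/flattenP/idP => [[K]|not_loop].
  rewrite inE => /predU1P[->|/mapP[c _ ->]]; rewrite ?mem_centre_circuit;
    by rewrite mem_component_circuit => /andP[].
have [comp_u|comp_u] := eqVneq (component (vcol I v)) (component (vcol I u)).
  exists centre_circuit; first exact: mem_head.
  by rewrite mem_centre_circuit mem_component_circuit not_loop -root_connect // comp_u eqxx.
have vs : v \in s (component (vcol I v)).
  by rewrite mem_component_circuit not_loop sym_connect_G' connect_root.
exists (s (component (vcol I v))) => //; rewrite inE map_f ?orbT //.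
rewrite mem_filter mem_enum inE andbT comp_u root_root // eqxx /=.
by apply: contraTneq vs => ->.
Qed.

Lemma component_system : circuit_system I centre_circuit (map s other_components).
Proof.
have uniq_s c : uniq (s c) by case: (circuit_s c).
have cycle_s c : path.cycle (follows (vcol I) (tcol I)) (s c) by case: (circuit_s c).
split.
- apply: uniq_flatten_src_disjoint component_circuits_disjoint.
  by rewrite /= rot_uniq uniq_s; apply/allP => _ /mapP[c _ ->].
- exact: mem_component_circuits.
- exact: centre_circuitE.
- by apply/allP => _ /mapP[c /other_componentsP[_ _ ?] ->].
- by rewrite /= rot_cycle cycle_s; apply/allP => _ /mapP[c _ ->].
- exact: component_circuits_disjoint.
Qed.

Lemma next_component_circuits T : (forall c v, v \in s c -> T v = next (s c) v) ->
  forall K v, K \in centre_circuit :: map s other_components -> v \in K -> T v = next K v.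
Proof.
move=> T_circuit K v; rewrite inE => /predU1P[->|/mapP[c _ ->]]; last exact: T_circuit.
rewrite mem_centre_circuit => vs; rewrite next_rot ?(T_circuit _ _ vs) //.
by case: (circuit_s (vcol I u)).
Qed.

End ComponentCircuits.

Lemma TA_optimal T : is_TA I T -> token_vertex_assignment I T /\
  exists2 sigma, solves_uncoloured I T sigma & optimal I (solves_coloured I) sigma.
Proof.
move=> [T_loop /fin_all_exists2[s circuit_s T_circuit]].
have sys := component_system circuit_s.
have prevsK := cancel_prevs sys T_loop (next_component_circuits circuit_s T_circuit).
split; first exact: prevs_assignment prevsK.
exists (centre_swaps u (plan_leaves I (centre_circuit s) (map s (other_components s)) leaf_loops)).
- exact: plan_solves_uncoloured.
- exact: (plan_optimal starI sys mem_leaf_loops).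
Qed.

Definition misplaced_leaves : seq V :=
  [seq v <- enum V | (v != u) && (vcol I v != tcol I v)].

Definition euler_centre : seq V * seq V :=
  euler_from (vcol I) (tcol I) u misplaced_leaves.

Definition euler_others : seq (seq V) :=
  circuits (vcol I) (tcol I) (size euler_centre.2) euler_centre.2.

Lemma mem_misplaced_leaves v : (v \in u :: misplaced_leaves) = ~~ leaf_loop I v.
Proof.
rewrite inE mem_filter mem_enum inE andbT /leaf_loop leafE // negb_and negbK.
by case: eqP.
Qed.

Lemma uniq_misplaced_leaves : uniq (u :: misplaced_leaves).
Proof. by rewrite /= mem_filter eqxx /= filter_uniq // enum_uniq. Qed.

Lemma balanced_misplaced_leaves : balanced (vcol I) (tcol I) (u :: misplaced_leaves).
Proof.
have perm_enum : perm_eq (leaf_loops ++ (u :: misplaced_leaves)) (enum V).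
  apply: uniq_perm; rewrite ?enum_uniq //.
    rewrite cat_uniq filter_uniq ?enum_uniq // uniq_misplaced_leaves andbT andTb.
    by apply/hasPn => v; rewrite mem_misplaced_leaves /= mem_leaf_loops.
  by move=> v; rewrite mem_cat mem_leaf_loops mem_misplaced_leaves mem_enum inE orbN.
apply: (balanced_catr (s := leaf_loops)) => [c|].
  rewrite !count_filter; apply: eq_count => v /=.
  by rewrite /leaf_loop; case: (vcol I v =P tcol I v) => [->|_]; rewrite ?andbF.
apply: (perm_balanced (s := enum V)); first by rewrite perm_sym.
have cardE p : #|[set v | p v]| = count p (enum V).
  by rewrite cardsE cardE {1}/enum_mem -enumT size_filter; apply: eq_count.
by move=> c; case: starI => _ card_eq _; rewrite -!cardE.
Qed.

Lemma euler_centreP :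
  [/\ perm_eq (euler_centre.1 ++ euler_centre.2) (u :: misplaced_leaves),
      euler_centre.1 = u :: behead euler_centre.1,
      path.cycle (follows (vcol I) (tcol I)) euler_centre.1,
      balanced (vcol I) (tcol I) euler_centre.2
    & src_disjoint (vcol I) euler_centre.1 euler_centre.2].
Proof.
have := euler_fromP balanced_misplaced_leaves; rewrite -/euler_centre.
case: euler_centre => K0 rest /= [permK start cycK bal disj]; split=> //.
by case: (K0) start => //= x K [->].
Qed.

Lemma euler_system : circuit_system I euler_centre.1 euler_others.
Proof.
have [permK K0E cycK bal disj] := euler_centreP.
have [perm_flat nonempty cycles disjs] := circuitsP (leqnn _) bal.
have perm_all : perm_eq (flatten (euler_centre.1 :: euler_others)) (u :: misplaced_leaves).
  by apply: perm_trans permK; rewrite perm_cat2l.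
split=> //.
- by rewrite (perm_uniq perm_all) uniq_misplaced_leaves.
- by move=> v; rewrite (perm_mem perm_all) mem_misplaced_leaves.
- by rewrite /= cycK.
rewrite /= disjs andbT; apply/allP => K Kin; apply/allrelP => v w vK wK.
apply: (allrelP disj) => //; rewrite -(perm_mem perm_flat).
by apply/flattenP; exists K.
Qed.

Lemma TA_exists : exists T, is_TA I T.
Proof. exact: system_TA euler_system. Qed.

End Assignment.

(** * Polynomial bounds *)

Definition poly_bounded (f : nat -> nat) : Prop :=
  exists k, forall n, (f n <= k * n.+1 ^ k)%N.

Lemma poly_bounded_const c : poly_bounded (fun => c).
Proof. by exists c => n; rewrite leq_pmulr // expn_gt0. Qed.

Lemma poly_bounded_id : poly_bounded id.
Proof. by exists 1%N => n; rewrite mul1n expn1. Qed.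

Lemma poly_bounded_add f g : poly_bounded f -> poly_bounded g ->
  poly_bounded (fun n => f n + g n)%N.
Proof.
move=> [k f_le] [l g_le]; exists (k + l)%N => n; rewrite mulnDl leq_add //.
  by apply: leq_trans (f_le n) _; rewrite leq_mul // leq_pexp2l // leq_addr.
by apply: leq_trans (g_le n) _; rewrite leq_mul // leq_pexp2l // leq_addl.
Qed.

Lemma poly_bounded_mul f g : poly_bounded f -> poly_bounded g ->
  poly_bounded (fun n => f n * g n)%N.
Proof.
move=> [k f_le] [l g_le]; exists (k * l + (k + l))%N => n.
apply: leq_trans (leq_mul (f_le n) (g_le n)) _.
by rewrite mulnACA -expnD leq_mul ?leq_addr // leq_pexp2l // leq_addl.
Qed.

Lemma poly_bounded_expn f : poly_bounded f -> exists k, forall n, (f n <= k * n ^ k + k)%N.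
Proof.
move=> [[|k] f_le]; first by exists 0%N.
exists (k.+1 * 2 ^ k.+1)%N => -[|n]; apply: leq_trans (f_le _) _.
  by rewrite exp1n muln1 (leq_trans _ (leq_addl _ _)) // leq_pmulr // expn_gt0.
apply: (leq_trans _ (leq_addr _ _)); rewrite -mulnA leq_mul //.
apply: (@leq_trans ((2 * n.+1) ^ k.+1)); first by rewrite leq_exp2r //; lia.
by rewrite expnMn leq_mul // leq_pexp2l // leq_pmulr // expn_gt0.
Qed.

(** * The program *)

Definition main_fun : nat := 0.
Definition eq_fun : nat := 1.
Definition nth_fun : nat := 2.
Definition edges_fun : nat := 3.
Definition classify_fun : nat := 4.
Definition extract_fun : nat := 5.
Definition hierholzer_fun : nat := 6.
Definition pivot_min_fun : nat := 7.
Definition pivot_circuit_fun : nat := 8.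
Definition circuits_fun : nat := 9.
Definition cat_fun : nat := 10.
Definition insert_at_fun : nat := 11.
Definition excursion_fun : nat := 12.
Definition excursions_fun : nat := 13.
Definition add_for_each_fun : nat := 14.
Definition cheaper_fun : nat := 15.
Definition detour_stay_fun : nat := 16.
Definition detour_other_fun : nat := 17.
Definition detour_loop_fun : nat := 18.
Definition swaps_fun : nat := 19.
Definition plan_fun : nat := 20.

Local Notation x0 := (EVar 0).
Local Notation x1 := (EVar 1).
Local Notation x2 := (EVar 2).
Local Notation x3 := (EVar 3).
Local Notation x5 := (EVar 5).
Local Notation x6 := (EVar 6).

Local Notation ehead := EFst.
Local Notation etail := ESnd.
Local Notation econs := EPair.
Local Notation esucc := (EPair ENil).
Local Notation epred := ESnd.
Local Notation etrue := (EPair ENil ENil).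
Local Notation efalse := ENil.

Local Notation triple e1 e2 e3 := (EPair e1 (EPair e2 e3)).
Local Notation proj1 e := (EFst e).
Local Notation proj2 e := (EFst (ESnd e)).
Local Notation proj3 e := (ESnd (ESnd e)).

(* An edge of G is encoded by [enc_edge], a circuit with a pivot by
   [enc_pivoted], and None by nil. *)
Definition edge_weight (e : expr) : expr := EFst e.
Definition edge_index (e : expr) : expr := EFst (ESnd e).
Definition edge_src (e : expr) : expr := EFst (ESnd (ESnd e)).
Definition edge_tgt (e : expr) : expr := ESnd (ESnd (ESnd e)).

Definition pivoted_weight (e : expr) : expr := EFst e.
Definition pivoted_before (e : expr) : expr := EFst (ESnd e).
Definition pivoted_pivot (e : expr) : expr := EFst (ESnd (ESnd e)).
Definition pivoted_after (e : expr) : expr := ESnd (ESnd (ESnd e)).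

(* The local definitions of a body name the components of its argument [x]; the
   variable that holds the argument is shifted by the enclosing [ELet]. *)

Definition eq_body : expr :=
  let a x := EFst x in
  let b x := ESnd x in
  EIf (a x0)
    (EIf (b x0) (ECall eq_fun (EPair (epred (a x0)) (epred (b x0)))) efalse)
    (EIf (b x0) efalse etrue).

Definition nth_body : expr :=
  let index x := EFst x in
  let s x := ESnd x in
  EIf (index x0) (ECall nth_fun (EPair (epred (index x0)) (etail (s x0)))) (ehead (s x0)).

Definition edges_body : expr :=
  let first_index x := proj1 x in
  let colours x := proj2 x in
  let weights x := proj3 x in
  EIf (colours x0)
    (ELet (ECall nth_fun (EPair (ESnd (ehead (colours x0))) (weights x0)))
    (ELet (ECall edges_fun
             (triple (esucc (first_index x1)) (etail (colours x1)) (weights x1)))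
      (econs (triple x1 (first_index x2) (ehead (colours x2))) x0)))
    ENil.

Definition classify_body : expr :=
  let centre x := EFst x in
  let edges x := ESnd x in
  let centre_edge x := proj1 x in
  let misplaced x := proj2 x in
  let loops x := proj3 x in
  EIf (edges x0)
    (ELet (ECall classify_fun (EPair (centre x0) (etail (edges x0))))
    (ELet (ECall eq_fun (EPair (centre x1) (edge_index (ehead (edges x1)))))
      (EIf x0
        (triple (ehead (edges x2)) (misplaced x1) (loops x1))
        (ELet (ECall eq_fun (EPair (edge_src (ehead (edges x2)))
                                   (edge_tgt (ehead (edges x2)))))
          (EIf x0
            (triple (centre_edge x2) (misplaced x2) (econs (ehead (edges x3)) (loops x2)))
            (triple (centre_edge x2) (econs (ehead (edges x3)) (misplaced x2)) (loops x2)))))))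
    (triple ENil ENil ENil).

Definition extract_body : expr :=
  let colour x := EFst x in
  let rest x := ESnd x in
  EIf (rest x0)
    (ELet (ECall eq_fun (EPair (colour x0) (edge_src (ehead (rest x0)))))
      (EIf x0
        (rest x1)
        (ELet (ECall extract_fun (EPair (colour x1) (etail (rest x1))))
          (EIf x0 (EPair (EFst x0) (econs (ehead (rest x2)) (ESnd x0))) ENil))))
    ENil.

Definition hierholzer_body : expr :=
  let stack x := proj1 x in
  let out x := proj2 x in
  let rest x := proj3 x in
  EIf (stack x0)
    (ELet (ECall extract_fun (EPair (edge_tgt (ehead (stack x0))) (rest x0)))
      (EIf x0
        (ECall hierholzer_fun
           (triple (econs (EFst x0) (stack x1)) (out x1) (ESnd x0)))
        (ECall hierholzer_fun
           (triple (etail (stack x1)) (econs (ehead (stack x1)) (out x1)) (rest x1)))))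
    (EPair (out x0) (rest x0)).

Definition pivot_min_body : expr :=
  let key x := EFst x in
  let before x := proj1 x in
  let pivot x := proj2 x in
  let after x := proj3 x in
  EIf (etail x0)
    (ELet (ECall pivot_min_fun (etail x0))
      (EIf (ELe (key (ehead x1)) (key (pivot x0)))
        (triple ENil (ehead x1) (etail x1))
        (triple (econs (ehead x1) (before x0)) (pivot x0) (after x0))))
    (triple ENil (ehead x0) ENil).

Definition pivot_circuit_body : expr :=
  ELet (ECall pivot_min_fun x0) (EPair (edge_weight (proj2 x0)) x0).

Definition circuits_body : expr :=
  EIf x0
    (ELet (ECall hierholzer_fun (triple (econs (ehead x0) ENil) ENil (etail x0)))
    (ELet (ECall pivot_circuit_fun (EFst x0))
    (ELet (ECall circuits_fun (ESnd x1))
      (econs x1 x0))))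
    ENil.

Definition cat_body : expr :=
  let a x := EFst x in
  let b x := ESnd x in
  EIf (a x0)
    (ELet (ECall cat_fun (EPair (etail (a x0)) (b x0)))
      (econs (ehead (a x1)) x0))
    (b x0).

Definition insert_at_body : expr :=
  let circuit x := EFst x in
  let middle x := ESnd x in
  ELet (ECall cat_fun (EPair (middle x0) (pivoted_after (circuit x0))))
    (ECall cat_fun (EPair (pivoted_before (circuit x1))
                          (econs (pivoted_pivot (circuit x1)) x0))).

Definition excursion_body : expr :=
  ELet (ECall insert_at_fun x0) (ECall cat_fun (EPair x0 (econs (ehead x0) ENil))).

Definition excursions_body : expr :=
  EIf x0
    (ELet (ECall excursion_fun (EPair (ehead x0) ENil))
    (ELet (ECall excursions_fun (etail x1))
      (ECall cat_fun (EPair x1 x0))))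
    ENil.

Definition add_for_each_body : expr :=
  let summand x := proj1 x in
  let start x := proj2 x in
  let s x := proj3 x in
  EIf (s x0)
    (ELet (ECall add_for_each_fun (triple (summand x0) (start x0) (etail (s x0))))
      (EAdd (summand x1) x0))
    (start x0).

Definition cheaper_body : expr :=
  let detour x := EFst x in
  let alternative x := ESnd x in
  let extra x := EFst x in
  EIf (alternative x0)
    (EIf (ELe (extra (alternative x0)) (extra (detour x0))) (alternative x0) (detour x0))
    (detour x0).

Definition detour_stay_body : expr :=
  let weight x := EFst x in
  let circuits x := ESnd x in
  ELet (ECall add_for_each_fun
          (triple (weight x0) (ESub (weight x0) (weight x0)) (circuits x0)))
  (ELet (ECall excursions_fun (circuits x1))
    (EPair x1 x0)).

Definition detour_other_body : expr :=
  let weight x := EFst x in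
  let circuits x := ESnd x in
  let before x := proj1 x in
  let pivot x := proj2 x in
  let after x := proj3 x in
  EIf (circuits x0)
    (ELet (ECall pivot_min_fun (circuits x0))
    (ELet (ECall cat_fun (EPair (before x0) (after x0)))
    (ELet (ECall add_for_each_fun (triple (pivoted_weight (pivot x1)) (weight x2) x0))
    (ELet (ECall excursions_fun x1)
    (ELet (ECall excursion_fun (EPair (pivot x3) x0))
      (EPair x2 x0))))))
    ENil.

Definition detour_loop_body : expr :=
  let weight x := proj1 x in
  let circuits x := proj2 x in
  let loops x := proj3 x in
  let pivot x := proj2 x in
  EIf (loops x0)
    (ELet (ECall pivot_min_fun (loops x0))
    (ELet (ECall add_for_each_fun
             (triple (edge_weight (pivot x0))
                     (EAdd (weight x1) (edge_weight (pivot x0)))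
                     (circuits x1)))
    (ELet (ECall excursions_fun (circuits x2))
    (ELet (ECall excursion_fun
             (EPair (EPair (edge_weight (pivot x2)) (triple ENil (pivot x2) ENil)) x0))
      (EPair x2 x0)))))
    ENil.

Definition swaps_body : expr :=
  let centre x := EFst x in
  let leaves x := ESnd x in
  EIf (leaves x0)
    (ELet (ECall swaps_fun (EPair (centre x0) (etail (leaves x0))))
      (econs (EPair (centre x1) (edge_index (ehead (leaves x1)))) x0))
    ENil.

Definition plan_body : expr :=
  let circuit x := proj1 x in
  let others x := proj2 x in
  let loops x := proj3 x in
  let detour_leaves x := ESnd x in
  ELet (ECall detour_stay_fun (EPair (pivoted_weight (circuit x0)) (others x0)))
  (ELet (ECall detour_other_fun (EPair (pivoted_weight (circuit x1)) (others x1)))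
  (ELet (ECall cheaper_fun (EPair x1 x0))
  (ELet (ECall detour_loop_fun
           (triple (pivoted_weight (circuit x3)) (others x3) (loops x3)))
  (ELet (ECall cheaper_fun (EPair x1 x0))
  (ELet (ECall insert_at_fun (EPair (circuit x5) (detour_leaves x0)))
    (etail x0)))))).

Definition main_body : expr :=
  let centre x := EFst x in
  let colours_weights x := ESnd x in
  let centre_edge x := proj1 x in
  let misplaced x := proj2 x in
  let loops x := proj3 x in
  ELet (ECall edges_fun (EPair ENil (colours_weights x0)))
  (ELet (ECall classify_fun (EPair (centre x1) x0))
  (ELet (ECall hierholzer_fun (triple (econs (centre_edge x0) ENil) ENil (misplaced x0)))
  (ELet (ECall pivot_circuit_fun (EFst x0))
  (ELet (ECall circuits_fun (ESnd x1))
  (ELet (ECall plan_fun (triple x1 x0 (loops x3)))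
    (ECall swaps_fun (EPair (centre x6) x0))))))).

Definition swap_program : program :=
  [:: main_body; eq_body; nth_body; edges_body; classify_body; extract_body;
      hierholzer_body; pivot_min_body; pivot_circuit_body; circuits_body;
      cat_body; insert_at_body; excursion_body; excursions_body;
      add_for_each_body; cheaper_body; detour_stay_body; detour_other_body;
      detour_loop_body; swaps_body; plan_body].

(** * Evaluation *)

Fixpoint call_free (e : expr) : bool :=
  match e with
  | EVar _ | ENil => true
  | EFst e | ESnd e => call_free e
  | EPair e1 e2 | EAdd e1 e2 | ESub e1 e2 | ELe e1 e2 =>
      call_free e1 && call_free e2
  | _ => false
  end.

Fixpoint duration (e : expr) : nat :=
  match e with
  | EFst e | ESnd e => (duration e).+1
  | EPair e1 e2 | EAdd e1 e2 | ESub e1 e2 | ELe e1 e2 =>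
      (duration e1 + duration e2).+1
  | _ => 1
  end.

Section Evaluation.

Variable R : realFieldType.

Implicit Types (env : seq (data R)) (e : expr) (x y : data R).

Fixpoint value env e : data R :=
  match e with
  | EVar i => nth DNil env i
  | EPair e1 e2 => DPair (value env e1) (value env e2)
  | EFst e => dfst (value env e)
  | ESnd e => dsnd (value env e)
  | EAdd e1 e2 => dadd (value env e1) (value env e2)
  | ESub e1 e2 => dsub (value env e1) (value env e2)
  | ELe e1 e2 => dle (value env e1) (value env e2)
  | _ => DNil
  end.

Lemma eval_call_free p env e : call_free e -> eval p env e (value env e) (duration e).
Proof.
by elim: e => //= [*|*|e1 IH1 e2 IH2 /andP[/IH1 ? /IH2 ?]|e IH /IH ?|e IH /IH ?
  |e1 IH1 e2 IH2 /andP[/IH1 ? /IH2 ?]|e1 IH1 e2 IH2 /andP[/IH1 ? /IH2 ?]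
  |e1 IH1 e2 IH2 /andP[/IH1 ? /IH2 ?]]; constructor.
Qed.

Definition evaluates env e x (b : nat) : Prop :=
  exists2 t, eval swap_program env e x t & (t <= b)%N.

Definition runs (f : nat) x y (b : nat) : Prop :=
  evaluates [:: x] (nth ENil swap_program f) y b.

Lemma evaluates_le env e x b b' :
  evaluates env e x b -> (b <= b')%N -> evaluates env e x b'.
Proof. by move=> [t ev tb] bb'; exists t => //; apply: leq_trans bb'. Qed.

Lemma evaluates_value env e x : call_free e -> value env e = x ->
  evaluates env e x (duration e).
Proof. by move=> cf <-; exists (duration e) => //; apply: eval_call_free. Qed.

Lemma evaluates_if env e e1 e2 x b : call_free e ->
  evaluates env (if dtrue (value env e) then e1 else e2) x b ->
  evaluates env (EIf e e1 e2) x (duration e + b).+1.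
Proof.
move=> cf [t ev tb]; exists (duration e + t).+1; last by rewrite ltnS leq_add2l.
exact: eval_if (eval_call_free _ _ cf) ev.
Qed.

Lemma evaluates_call env f e x b : call_free e ->
  runs f (value env e) x b -> evaluates env (ECall f e) x (duration e + b).+1.
Proof.
move=> cf [t ev tb]; exists (duration e + t).+1; last by rewrite ltnS leq_add2l.
exact: eval_call (eval_call_free _ _ cf) ev.
Qed.

Lemma evaluates_let env f e e' x y b b' : call_free e ->
  runs f (value env e) x b -> evaluates (x :: env) e' y b' ->
  evaluates env (ELet (ECall f e) e') y ((duration e + b).+1 + b').+1.
Proof.
move=> cf /(evaluates_call cf)[t ev tb] [t' ev' tb'].
exists (t + t').+1; first exact: eval_let ev ev'.
by rewrite ltnS leq_add.
Qed.

End Evaluation.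

(** * Correctness and running time of the program *)

Ltac run_body body :=
  rewrite /runs [nth _ _ _]/= /body; cbv zeta beta; eapply evaluates_le.
Ltac eval_if := eapply evaluates_if; [reflexivity | rewrite /=].
Ltac eval_let := eapply evaluates_let; [reflexivity | rewrite /= | ].
Ltac eval_call := eapply evaluates_call; [reflexivity | rewrite /=].
Ltac eval_value := eapply evaluates_value; [reflexivity | rewrite /=].
Ltac within bound := refine (evaluates_le (b' := bound) _ _).
Ltac eval_value_within bound := within bound; [eval_value | ].

Section Lists.

Variable R : realFieldType.

Lemma runs_eq a b :
  runs eq_fun (DPair (enc_nat R a) (enc_nat R b)) (dbool R (a == b)) (20 * a + 20).
Proof.
elim: a b => [|a IH] [|b]; run_body eq_body;
  try (eval_if; eval_if; first [by eval_value | eval_call; exact: IH]);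
  by rewrite /=; lia.
Qed.

Lemma runs_nth i (s : seq (data R)) :
  runs nth_fun (DPair (enc_nat R i) (enc_seq s)) (nth DNil s i) (20 * i + 20).
Proof.
elim: i s => [|i IH] s; run_body nth_body.
- by eval_if; eval_value; case: s.
- by rewrite /=; lia.
- eval_if; eval_call; rewrite -nth_behead.
  have -> : dsnd (enc_seq s) = enc_seq (behead s) by case: s.
  exact: IH.
- by rewrite /=; lia.
Qed.

Lemma runs_cat (a b : seq (data R)) :
  runs cat_fun (DPair (enc_seq a) (enc_seq b)) (enc_seq (a ++ b)) (40 * size a + 20).
Proof.
elim: a => [|x a IH]; run_body cat_body.
- by eval_if; eval_value.
- by rewrite /=; lia.
- by eval_if; eval_let; [exact: IH | eval_value].
- by rewrite /=; lia.
Qed.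

Definition enc_parts (T : Type) (enc : T -> data R) (K : pivoted T) : data R :=
  DPair (enc_seq (map enc (before K))) (DPair (enc (pivot K)) (enc_seq (map enc (after K)))).

Lemma runs_pivot_min (T : Type) (enc : T -> data R) (key : T -> R) x s :
  (forall t, dfst (enc t) = DNum (key t)) ->
  runs pivot_min_fun (enc_seq (map enc (x :: s))) (enc_parts enc (pivot_min key x s))
    (100 * size s + 50).
Proof.
move=> encK; elim: s x => [|y s IH] x /=; run_body pivot_min_body.
- by eval_if; eval_value.
- by rewrite /=; lia.
- eval_if; eval_let; first exact: IH.
  eval_if; rewrite !encK /=.
  by case: (leP (key x)) => _ /=; eval_value_within 20%N.
- by rewrite /=; lia.
Qed.

Lemma runs_add_for_each (T : Type) (enc : T -> data R) m a s :
  runs add_for_each_fun (DPair (DNum m) (DPair (DNum a) (enc_seq (map enc s))))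
    (DNum (add_for_each m a s)) (60 * size s + 20).
Proof.
elim: s => [|x s IH]; run_body add_for_each_body.
- by eval_if; eval_value.
- by rewrite /=; lia.
- by eval_if; eval_let; [exact: IH | eval_value].
- by rewrite /=; lia.
Qed.

Lemma runs_eq_elt (X : finType) (x y : X) (N : nat) : (#|X| <= N)%N ->
  runs eq_fun (DPair (enc_elt R x) (enc_elt R y)) (dbool R (x == y)) (20 * N + 20).
Proof.
move=> XN; rewrite -(inj_eq enum_rank_inj) -val_eqE.
apply: evaluates_le (runs_eq _ _) _; rewrite leq_add2r leq_mul2l /=.
exact: leq_trans (ltnW (ltn_ord _)) XN.
Qed.

End Lists.

Lemma enum_rank_cat (X : finType) pre (x : X) s : enum X = pre ++ x :: s ->
  enum_rank x = size pre :> nat.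
Proof.
move=> enumE; apply/eqP; rewrite -(nth_uniq x _ _ (enum_uniq X)) ?nth_enum_rank.
- by rewrite enumE nth_cat ltnn subnn.
- by rewrite -cardE ltn_ord.
- by rewrite enumE size_cat /= addnS ltnS leq_addr.
Qed.

Section SizeExcursions.

Variable T : Type.
Implicit Types (K : pivoted T) (M : seq T) (Ks : seq (pivoted T)).

Lemma size_insert_at K M : size (insert_at K M) = (size (glue K) + size M)%N.
Proof. by rewrite !size_cat /= size_cat; lia. Qed.

Lemma size_excursion K M : size (excursion K M) = (size (glue K) + size M).+1.
Proof. by rewrite size_rcons size_insert_at. Qed.

Lemma size_excursions Ks : size (excursions Ks) = (size (glues Ks) + size Ks)%N.
Proof.
elim: Ks => // K Ks IH.
rewrite excursions_cons glues_cons size_cat (size_cat (glue K)) IH size_excursion /=.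
by lia.
Qed.

Lemma leq_size_excursions Ks : (size Ks <= size (excursions Ks))%N.
Proof. by rewrite size_excursions leq_addl. Qed.

Lemma size_glues_cat Ks Ks' : size (glues (Ks ++ Ks')) = (size (glues Ks) + size (glues Ks'))%N.
Proof. by rewrite /glues map_cat flatten_cat size_cat. Qed.

End SizeExcursions.

Section Algorithm.

Variables (R : realFieldType) (V C : finType) (I : instance R V C).

Local Notation u := (centre I).
Local Notation wt := (token_weight I).

Implicit Types (m : R) (s ls : seq V) (K : pivoted V) (Ks : seq (pivoted V)).

Definition enc_edge (v : V) : data R :=
  DPair (DNum (wt v))
    (DPair (enc_elt R v) (DPair (enc_elt R (vcol I v)) (enc_elt R (tcol I v)))).

Definition enc_edges s : data R := enc_seq (map enc_edge s).

Definition enc_pivoted K : data R := DPair (DNum (pivot_weight I K)) (enc_parts enc_edge K).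

Definition enc_pivoteds Ks : data R := enc_seq (map enc_pivoted Ks).

Definition enc_detour (d : detour R V) : data R :=
  DPair (DNum (detour_extra d)) (enc_edges (detour_leaves d)).

Definition enc_odetour (o : option (detour R V)) : data R := oapp enc_detour DNil o.

Lemma runs_edges N pre s : (#|C| <= N)%N -> enum V = pre ++ s ->
  runs edges_fun (DPair (enc_nat R (size pre))
    (DPair (enc_seq [seq DPair (enc_elt R (vcol I v)) (enc_elt R (tcol I v)) | v <- s])
           (enc_seq [seq DNum (weight I c) | c <- enum C])))
    (enc_edges s) (size s * (20 * N + 200) + 20).
Proof.
move=> CN; elim: s pre => [|v s IH] pre enumE; run_body edges_body.
- by eval_if; eval_value.
- by rewrite /=; lia.
- eval_if; eval_let.
    within (20 * N + 20)%N; first exact: runs_nth.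
    rewrite leq_add2r leq_mul2l /=; exact: leq_trans (ltnW (ltn_ord _)) CN.
  eval_let.
    have -> : DPair DNil (enc_nat R (size pre)) = enc_nat R (size (rcons pre v)).
      by rewrite size_rcons.
    by apply: IH; rewrite cat_rcons.
  eval_value; rewrite (nth_map (tcol I v)) -?cardE ?ltn_ord // nth_enum_rank.
  by rewrite /enc_edges /= /enc_edge /enc_elt (enum_rank_cat enumE).
- by rewrite /=; lia.
Qed.

Lemma runs_classify N s : star_instance I -> (#|V| <= N)%N -> (#|C| <= N)%N ->
  runs classify_fun (DPair (enc_elt R u) (enc_edges s))
    (DPair (if u \in s then enc_edge u else DNil)
       (DPair (enc_edges [seq v <- s | (v != u) && (vcol I v != tcol I v)])
              (enc_edges [seq v <- s | leaf_loop I v])))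
    (size s * (40 * N + 300) + 20).
Proof.
move=> starI VN CN; elim: s => [|v s IH]; run_body classify_body.
- by eval_if; eval_value.
- by rewrite /=; lia.
- eval_if; eval_let; first exact: IH.
  eval_let; first exact: runs_eq_elt VN.
  rewrite inE /= /leaf_loop leafE // (eq_sym v).
  case: (eqVneq u v) => [<-|vu] /=; within (20 * N + 150)%N.
  + by eval_if; eval_value.
  + by rewrite /=; lia.
  + eval_if; eval_let; first exact: runs_eq_elt CN.
    by case: eqP => _ /=; eval_if; eval_value_within 40%N.
  + by rewrite /=; lia.
- by rewrite /=; lia.
Qed.

Lemma runs_extract N c s : (#|C| <= N)%N ->
  runs extract_fun (DPair (enc_elt R c) (enc_edges s))
    (if extract (vcol I) c s is Some (w, r) then DPair (enc_edge w) (enc_edges r) else DNil)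
    (size s * (20 * N + 200) + 20).
Proof.
move=> CN; elim: s => [|w s IH]; run_body extract_body.
- by eval_if; eval_value.
- by rewrite /=; lia.
- eval_if; eval_let; first exact: runs_eq_elt CN.
  case: eqP => _ /=; within (size s * (20 * N + 200) + 100)%N.
  + by eval_if; eval_value.
  + by rewrite /=; lia.
  + eval_if; eval_let; first exact: IH.
    by case: extract => [[w' r]|]; eval_if; eval_value_within 20%N.
  + by rewrite /=; lia.
- by rewrite /=; lia.
Qed.

Definition hierholzer_time (N : nat) : nat := N * (20 * N + 200) + 200.

Lemma runs_hierholzer N n stack out rest : (#|C| <= N)%N ->
  (size rest <= N)%N -> ((size rest).*2 + size stack < n)%N ->
  let r := hierholzer (vcol I) (tcol I) n stack out rest in
  runs hierholzer_fun (DPair (enc_edges stack) (DPair (enc_edges out) (enc_edges rest)))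
    (DPair (enc_edges r.1) (enc_edges r.2)) (n * hierholzer_time N).
Proof.
move=> CN; elim: n stack out rest => [|n IH] stack out rest //= rest_le fuel.
have extract_le : (size rest * (20 * N + 200) <= N * (20 * N + 200))%N.
  by rewrite leq_mul2r rest_le orbT.
case: stack fuel => [|v stack] /= fuel; run_body hierholzer_body.
- by eval_if; eval_value.
- by rewrite /= /hierholzer_time; lia.
- eval_if; eval_let; first exact: runs_extract CN.
  case: extractP => [w r _ /perm_size /= size_r|_]; within (n * hierholzer_time N + 50)%N.
  + by eval_if; eval_call; apply: (IH [:: w, v & stack] out r) => /=; lia.
  + by rewrite /=; lia.
  + by eval_if; eval_call; apply: (IH stack (v :: out) rest) => //=; lia.
  + by rewrite /=; lia.
- rewrite /=; move: extract_le; rewrite /hierholzer_time (mulSn n).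
  by move: (N * _)%N (size rest * _)%N (n * _)%N => a b c; lia.
Qed.

Lemma runs_euler_from N b rest : (#|C| <= N)%N -> (size rest <= N)%N ->
  let r := euler_from (vcol I) (tcol I) b rest in
  runs hierholzer_fun (DPair (enc_edges [:: b]) (DPair (enc_edges [::]) (enc_edges rest)))
    (DPair (enc_edges r.1) (enc_edges r.2)) ((2 * N + 2) * hierholzer_time N).
Proof.
move=> CN rest_le; apply: evaluates_le (runs_hierholzer _ CN rest_le _) _.
  by rewrite addn1.
by rewrite leq_mul2r mul2n addn2 !ltnS leq_double rest_le orbT.
Qed.

Lemma runs_pivot_circuit v s :
  runs pivot_circuit_fun (enc_edges (v :: s)) (enc_pivoted (pivot_circuit I (v :: s)))
    (100 * size s + 100).
Proof.
run_body pivot_circuit_body.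
- eval_let; first exact: (runs_pivot_min (enc := enc_edge) (key := wt)).
  by eval_value.
- by rewrite /=; lia.
Qed.

Definition circuits_time (N : nat) : nat :=
  (2 * N + 2) * hierholzer_time N + 100 * N + 300.

Lemma runs_circuits N n rest : (#|C| <= N)%N -> (size rest <= N)%N ->
  (size rest <= n)%N -> balanced (vcol I) (tcol I) rest ->
  runs circuits_fun (enc_edges rest)
    (enc_pivoteds (map (pivot_circuit I) (circuits (vcol I) (tcol I) n rest)))
    (n * circuits_time N + 20).
Proof.
move=> CN; elim: n rest => [|n IH] [|b rest] //= rest_le fuel bal; run_body circuits_body;
  try (by eval_if; eval_value); try by rewrite /=; lia.
- have := runs_euler_from b CN (ltnW rest_le).
  have := euler_fromP bal; case: euler_from => circ rest' /= + runs_euler.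
  move=> [/perm_size + start _ bal' _]; rewrite size_cat /= => sizeE.
  eval_if; eval_let; first exact: runs_euler.
  case: circ start sizeE {runs_euler} => //= v s _ sizeE.
  eval_let; first by within (100 * N + 100)%N; [exact: runs_pivot_circuit | lia].
  have rest'_le : (size rest' <= size rest)%N by rewrite -ltnS -sizeE ltnS leq_addl.
  eval_let; last by eval_value.
  by apply: IH bal'; apply: leq_trans rest'_le _ => //; apply: ltnW.
- by rewrite /= /circuits_time; lia.
Qed.

Lemma runs_insert_at K ls :
  runs insert_at_fun (DPair (enc_pivoted K) (enc_edges ls)) (enc_edges (insert_at K ls))
    (40 * size (insert_at K ls) + 100).
Proof.
run_body insert_at_body.
- eval_let; first exact: runs_cat.
  eval_call; rewrite /enc_edges /insert_at map_cat map_cons map_cat.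
  exact: (runs_cat _ (_ :: _)).
- by rewrite /= !size_map /insert_at !size_cat /= size_cat; lia.
Qed.

Lemma runs_excursion K ls :
  runs excursion_fun (DPair (enc_pivoted K) (enc_edges ls)) (enc_edges (excursion K ls))
    (80 * size (excursion K ls) + 200).
Proof.
run_body excursion_body.
- eval_let; first exact: runs_insert_at.
  eval_call; rewrite /enc_edges /excursion -cats1 map_cat /=.
  have -> : dfst (enc_seq (map enc_edge (insert_at K ls))) = enc_edge (entry K).
    by case: K => [[|v B] p A].
  exact: (runs_cat _ [:: _]).
- by rewrite /excursion size_rcons /= size_map; lia.
Qed.

Lemma runs_excursions Ks :
  runs excursions_fun (enc_pivoteds Ks) (enc_edges (excursions Ks))
    (600 * size (excursions Ks) + 20).
Proof.
elim: Ks => [|K Ks IH]; run_body excursions_body.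
- by eval_if; eval_value.
- by [].
- eval_if; eval_let; first exact: (runs_excursion K [::]).
  eval_let; first exact: IH.
  by eval_call; rewrite excursions_cons /enc_edges map_cat; exact: runs_cat.
- rewrite excursions_cons (size_cat (excursion K [::])) /= size_map.
  have : (0 < size (excursion K [::]))%N by rewrite size_excursion.
  lia.
Qed.

Lemma runs_cheaper d o :
  runs cheaper_fun (DPair (enc_detour d) (enc_odetour o)) (enc_detour (cheaper d o)) 40.
Proof.
run_body cheaper_body.
- eval_if; case: o => [d'|] /=; within 30%N.
  + by eval_if; case: leP => _ /=; eval_value_within 10%N.
  + by [].
  + by eval_value.
  + by [].
- by [].
Qed.

Lemma runs_detour_stay m Ks :
  runs detour_stay_fun (DPair (DNum m) (enc_pivoteds Ks)) (enc_detour (detour_stay m Ks))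
    (700 * size (excursions Ks) + 200).
Proof.
run_body detour_stay_body.
- eval_let; first exact: runs_add_for_each.
  eval_let; first exact: runs_excursions.
  by eval_value.
- by rewrite size_excursions /=; lia.
Qed.

Lemma size_pivot_excursion K Ks (S := pivot_min (pivot_weight I) K Ks) :
  size (excursion (pivot S) (excursions (before S ++ after S))) = size (excursions (K :: Ks)).
Proof.
rewrite size_excursion -(glue_pivot_min (pivot_weight I) K Ks) -/S !size_excursions.
rewrite -[glue S]/(before S ++ pivot S :: after S) !size_glues_cat glues_cons.
by rewrite (size_cat (glue _)) !(size_cat (before S)) /=; lia.
Qed.

Lemma runs_detour_other m Ks :
  runs detour_other_fun (DPair (DNum m) (enc_pivoteds Ks)) (enc_odetour (detour_other I m Ks))
    (1200 * size (excursions Ks) + 600).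
Proof.
case: Ks => [|K Ks]; run_body detour_other_body.
- by eval_if; eval_value.
- by [].
- rewrite /detour_other [enc_odetour _]/=.
  eval_if; eval_let.
    exact: (runs_pivot_min (enc := enc_pivoted) (key := pivot_weight I)).
  eval_let; first exact: runs_cat.
  rewrite -map_cat; set S := pivot_min _ _ _.
  eval_let; first exact: (runs_add_for_each enc_pivoted).
  eval_let; first exact: runs_excursions.
  eval_let; first exact: runs_excursion.
  by eval_value.
- have le_exc := leq_size_excursions (K :: Ks).
  have exc_pivot := size_pivot_excursion K Ks; set S := pivot_min _ _ _ in exc_pivot *.
  have size_rest : (size (before S) + size (after S))%N = size Ks.
    by have := congr1 size (glue_pivot_min (pivot_weight I) K Ks); rewrite size_cat /= -/S; lia.
  have exc_rest : (size (excursions (before S ++ after S)) <= size (excursions (K :: Ks)))%N.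
    by rewrite -exc_pivot size_excursion; lia.
  rewrite size_map size_cat exc_pivot.
  by move: (size (excursions (K :: Ks))) le_exc exc_rest => e; rewrite /=; lia.
Qed.

Lemma runs_detour_loop m Ks ls :
  runs detour_loop_fun (DPair (DNum m) (DPair (enc_pivoteds Ks) (enc_edges ls)))
    (enc_odetour (detour_loop I m Ks ls))
    (1200 * size (excursions Ks) + 100 * size ls + 800).
Proof.
case: ls => [|l ls]; run_body detour_loop_body.
- by eval_if; eval_value.
- by rewrite /=; lia.
- rewrite /detour_loop [enc_odetour _]/=.
  eval_if; eval_let; first exact: (runs_pivot_min (enc := enc_edge) (key := wt)).
  eval_let; first exact: runs_add_for_each.
  eval_let; first exact: runs_excursions.
  eval_let; first exact: (runs_excursion (Pivoted [::] _ [::])).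
  by eval_value.
- by have := leq_size_excursions Ks; rewrite size_excursion /=; lia.
Qed.

Lemma size_cheaper (d : detour R V) o b : (size (detour_leaves d) <= b)%N ->
  (forall d', o = Some d' -> (size (detour_leaves d') <= b)%N) ->
  (size (detour_leaves (cheaper d o)) <= b)%N.
Proof. by move=> size_d; case: o => //= d' size_d'; case: ifP => // _; apply: size_d'. Qed.

Lemma size_best_detour m Ks ls :
  (size (detour_leaves (best_detour I m Ks ls)) <= size (excursions Ks) + 2)%N.
Proof.
rewrite /best_detour; apply: size_cheaper => [|d]; first apply: size_cheaper => [|d].
- exact: leq_addr.
- by case: Ks => // K Ks [<-]; rewrite size_pivot_excursion leq_addr.
- by case: ls => // l ls [<-]; rewrite size_excursion /=; lia.
Qed.

Lemma runs_plan K Ks ls :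
  runs plan_fun (DPair (enc_pivoted K) (DPair (enc_pivoteds Ks) (enc_edges ls)))
    (enc_edges (plan I K Ks ls))
    (4000 * size (excursions Ks) + 40 * size (glue K) + 100 * size ls + 3000).
Proof.
run_body plan_body.
- eval_let; first exact: runs_detour_stay.
  eval_let; first exact: runs_detour_other.
  eval_let; first exact: runs_cheaper.
  eval_let; first exact: runs_detour_loop.
  eval_let; first exact: runs_cheaper.
  eval_let; first exact: runs_insert_at.
  by eval_value; rewrite /plan /best_detour; case: (insert_at _ _).
- have := size_best_detour (pivot_weight I K) Ks ls.
  rewrite size_insert_at /best_detour.
  move: (size (detour_leaves _)) (size (excursions Ks)) (size (glue K)) => d e k.
  by rewrite /=; lia.
Qed.

Lemma runs_swaps v ls :
  runs swaps_fun (DPair (enc_elt R v) (enc_edges ls)) (enc_swaps R (centre_swaps v ls))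
    (60 * size ls + 20).
Proof.
elim: ls => [|l ls IH]; run_body swaps_body.
- by eval_if; eval_value.
- by rewrite /=; lia.
- by eval_if; eval_let; [exact: IH | eval_value].
- by rewrite /=; lia.
Qed.

End Algorithm.

Definition main_time (N : nat) : nat :=
  (N * (20 * N + 200) + 20) + (N * (40 * N + 300) + 20)
  + (2 * N + 2) * hierholzer_time N + (N * circuits_time N + 20)
  + (N * 2 * 4000 + N * 1000 + 4500).

Lemma poly_bounded_main_time : poly_bounded main_time.
Proof.
rewrite /main_time /circuits_time /hierholzer_time.
by repeat first [exact: poly_bounded_id | exact: poly_bounded_const
                | apply: poly_bounded_add | apply: poly_bounded_mul].
Qed.

Section Main.

Variables (R : realFieldType) (V C : finType) (I : instance R V C).
Hypothesis starI : star_instance I.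

Local Notation u := (centre I).
Local Notation K0 := (euler_centre I).1.
Local Notation Ks := (euler_others I).
Local Notation Ps := (map (pivot_circuit I) Ks).
Local Notation N := (#|V| + #|C|)%N.

Definition optimal_leaves : seq V := plan_leaves I K0 Ks (leaf_loops I).

Lemma leq_size_uniq (s : seq V) : uniq s -> (size s <= N)%N.
Proof. by move/card_uniqP <-; apply: leq_trans (max_card _) (leq_addr _ _). Qed.

Lemma size_filter_enum (p : pred V) : (size [seq v <- enum V | p v] <= N)%N.
Proof. by rewrite leq_size_uniq // filter_uniq ?enum_uniq. Qed.

Lemma size_leaf_loops : (size (leaf_loops I) <= N)%N.
Proof. exact: size_filter_enum. Qed.

Lemma size_euler_circuits : (size K0 + size (flatten Ks) <= N)%N.
Proof. by rewrite -size_cat leq_size_uniq //; apply: system_uniq (euler_system starI). Qed.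

Lemma size_euler_others : (size Ks <= size (flatten Ks))%N.
Proof.
have := system_nonempty (euler_system starI); elim: Ks => //= K L IH /andP[K0 /IH le_L].
by rewrite size_cat -add1n leq_add // lt0n size_eq0.
Qed.

Lemma size_euler_excursions : (size (excursions Ps) <= 2 * size (flatten Ks))%N.
Proof.
rewrite size_excursions (glues_circuits (euler_system starI)) size_map.
by have := size_euler_others; lia.
Qed.

Lemma size_euler_rest : (size (euler_centre I).2 <= N)%N.
Proof.
have [/perm_uniq] := euler_centreP starI; rewrite (uniq_misplaced_leaves I) cat_uniq.
by case/and3P=> _ _ ? _ _ _ _; apply: leq_size_uniq.
Qed.

Lemma glue_euler_centre : glue (pivot_circuit I K0) = K0.
Proof. exact: glue_centre_circuit (euler_system starI). Qed.

Lemma size_optimal_leaves : (size optimal_leaves <= 3 * N + 2)%N.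
Proof.
rewrite /optimal_leaves /plan_leaves /plan size_behead size_insert_at glue_euler_centre.
have := size_best_detour I (pivot_weight I (pivot_circuit I K0)) Ps (leaf_loops I).
by have := size_euler_circuits; have := size_euler_excursions; lia.
Qed.

Let card_C_le : (#|C| <= N)%N := leq_addl _ _.
Let card_V_le : (#|V| <= N)%N := leq_addr _ _.

Lemma runs_all_edges : runs edges_fun
  (DPair DNil
    (DPair (enc_seq [seq DPair (enc_elt R (vcol I v)) (enc_elt R (tcol I v)) | v <- enum V])
           (enc_seq [seq DNum (weight I c) | c <- enum C])))
  (enc_edges I (enum V)) (N * (20 * N + 200) + 20).
Proof.
apply: evaluates_le (runs_edges (pre := [::]) I card_C_le erefl) _.
by rewrite -cardE leq_add2r leq_mul2r card_V_le orbT.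
Qed.

Lemma runs_classify_all : runs classify_fun
  (DPair (enc_elt R u) (enc_edges I (enum V)))
  (DPair (enc_edge I u)
    (DPair (enc_edges I (misplaced_leaves I)) (enc_edges I (leaf_loops I))))
  (N * (40 * N + 300) + 20).
Proof.
have := runs_classify (enum V) starI card_V_le card_C_le; rewrite mem_enum inE => runs_enum.
by apply: evaluates_le runs_enum _; rewrite -cardE leq_add2r leq_mul2r card_V_le orbT.
Qed.

Lemma runs_pivot_centre : runs pivot_circuit_fun (enc_edges I K0)
  (enc_pivoted I (pivot_circuit I K0)) (100 * size K0 + 100).
Proof.
have [_ -> _ _ _] := euler_centreP starI.
by apply: evaluates_le (runs_pivot_circuit I u _) _; rewrite /=; lia.
Qed.

Lemma runs_euler_others : runs circuits_fun (enc_edges I (euler_centre I).2)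
  (enc_pivoteds I Ps) (N * circuits_time N + 20).
Proof.
have [_ _ _ bal _] := euler_centreP starI.
apply: evaluates_le (runs_circuits card_C_le size_euler_rest (leqnn _) bal) _.
by rewrite leq_add2r leq_mul2r size_euler_rest orbT.
Qed.

Lemma runs_main : runs main_fun (enc_instance I)
  (enc_swaps R (centre_swaps u optimal_leaves)) (main_time N).
Proof.
run_body main_body.
- eval_let; first exact: runs_all_edges.
  eval_let; first exact: runs_classify_all.
  eval_let; first exact: (runs_euler_from I u card_C_le (size_filter_enum _)).
  eval_let; first exact: runs_pivot_centre.
  eval_let; first exact: runs_euler_others.
  eval_let; first exact: runs_plan.
  by eval_call; exact: runs_swaps.
- move: size_euler_circuits size_euler_excursions size_leaf_loops size_optimal_leaves.
  rewrite glue_euler_centre /main_time -/optimal_leaves.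
  move: (size K0) (size (flatten Ks)) (size (excursions Ps)) (size (leaf_loops I)).
  move: (size optimal_leaves) (N * (20 * N + 200))%N (N * (40 * N + 300))%N.
  move: ((2 * N + 2) * _)%N (N * circuits_time N)%N.
  by rewrite /=; clear; lia.
Qed.

End Main.

Lemma star_swapping_polynomial : polynomial_time_solvable.
Proof.
have [k main_time_le] := poly_bounded_expn poly_bounded_main_time.
exists swap_program, k => R V C I starI.
have [t computes_plan t_le] := runs_main starI.
exists (centre_swaps (centre I) (optimal_leaves I)), t; split=> //.
- by apply: plan_optimal; [|exact: euler_system|exact: mem_leaf_loops].
- exact: leq_trans t_le (main_time_le _).
Qed.

Theorem theorem6p8 :
  (forall (R : realFieldType) (V C : finType) (I : instance R V C),
    star_instance I ->
    [/\ (exists TA : V -> V, is_TA I TA),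
        (forall T : V -> V, token_vertex_assignment I T ->
           exists x : R, Fcost I T x)
      & forall TA : V -> V, is_TA I TA ->
        [/\ token_vertex_assignment I TA,
            (forall sigma : seq (V * V),
               optimal I (solves_uncoloured I TA) sigma ->
               optimal I (solves_coloured I) sigma)
          & exists m : R,
            [/\ Fcost I TA m,
                is_minimum (fun x : R => exists2 T : V -> V,
                  token_vertex_assignment I T & Fcost I T x) m
              & min_cost I (solves_coloured I) m]]])
  /\ polynomial_time_solvable.
Proof.
split; last exact: star_swapping_polynomial.
move=> R V C I starI; split; first exact: TA_exists.
  by move=> T [bijT _]; apply: Fcost_exists.
move=> TA /(TA_optimal starI)[assignTA [sigma solTA opt]].
split=> //; first by move=> tau; apply: optimal_uncoloured_coloured opt _.
exists (cost I sigma); split.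
- exact: Fcost_optimal.
- exact: min_Fcost_optimal solTA opt.
- exact: min_cost_optimal.
Qed.
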